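(* If a finitely generated group $C$ is a subgroup of two hyperbolic groups $A$ and $B$, and $C$ is quasi-convex and malnormal in $A$, then the amalgamated free product $\Gamma=A\ast_C B$ is hyperbolic. (No assumption is made on how $C$ sits in $B$.)
   Context: ''Hyperbolic'' means Gromov-hyperbolic. A subgroup $C\le A$ is malnormal when $g^{-1}Cg\cap C=\{1\}$ for all $g\in A\smallsetminus C$. *)

(* Defs.v *)
From mathcomp Require Import all_boot all_order all_algebra.
From mathcomp Require Import boolp classical_sets.
Set Implicit Arguments.
Unset Strict Implicit.
Unset Printing Implicit Defensive.
Import Order.TTheory GRing.Theory Num.Theory.
Local Open Scope classical_set_scope.

(* Groups are arbitrary, possibly infinite, [groupType]s. *)

Notation "{ 'ghom' G -> H }" := (UMagmaMorphism.type G H)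
  (at level 0, G at level 98, H at level 99,
   format "{ 'ghom'  G  ->  H }") : type_scope.

Section WordMetric.
Variables (G : groupType) (S : seq G).

(* The generators and their inverses are the letters. *)
Definition word (w : seq G) : Prop :=
  forall x, x \in w -> x \in S \/ (x^-1)%g \in S.

Definition word_value (w : seq G) : G := (\prod_(x <- w) x)%g.

Definition generates : Prop :=
  forall g, exists2 w, word w & word_value w = g.

Definition has_word_of_size (g : G) (n : nat) : bool :=
  `[< exists w, [/\ word w, word_value w = g & size w = n] >].

(* The value 0 for an element that is not a product of letters is junk; it does
   not occur when S generates G. *)
Definition word_length (g : G) : nat :=
  match pselect (exists n, has_word_of_size g n) with
  | left ex => ex_minn ex
  | right _ => 0
  end.

(* When S generates G, this is the path metric of the Cayley graph of (G, S)
   (edges from g to g * s), restricted to vertices. *)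
Definition word_dist (g h : G) : nat := word_length (g^-1 * h)%g.

(* p 0, ..., p n are the successive vertices of a geodesic edge path of the
   Cayley graph. *)
Definition geodesic (n : nat) (p : nat -> G) : Prop :=
  forall i j, i <= j <= n -> word_dist (p i) (p j) = j - i.

Local Open Scope ring_scope.

Definition gromov_product (x y w : G) : rat :=
  ((word_dist x w)%:R + (word_dist y w)%:R - (word_dist x y)%:R) / 2%:R.

(* The constant is rational since the Gromov products are. *)
Definition gromov_hyperbolic_metric : Prop :=
  exists delta : rat, forall x y z w : G,
    Num.min (gromov_product x z w) (gromov_product z y w) - delta
      <= gromov_product x y w.

Definition quasi_convex_wrt (H : set G) : Prop :=
  exists K : nat, forall (n : nat) (p : nat -> G),
    geodesic n p -> H (p 0%N) -> H (p n) ->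
    forall i, (i <= n)%N -> exists2 h, H h & (word_dist (p i) h <= K)%N.

End WordMetric.

Definition finitely_generated (G : groupType) : Prop :=
  exists S : seq G, generates S.

(* Hyperbolicity does not depend on the finite generating set, so one such set
   is asked for; this includes finite generation. *)
Definition hyperbolic (G : groupType) : Prop :=
  exists2 S : seq G, generates S & gromov_hyperbolic_metric S.

(* Within a hyperbolic group, this does not depend on the finite generating set
   either. *)
Definition quasi_convex (G : groupType) (H : set G) : Prop :=
  exists2 S : seq G, generates S & quasi_convex_wrt S H.

Definition malnormal (G : groupType) (H : set G) : Prop :=
  forall g : G, ~ H g -> [set (g^-1 * x * g)%g | x in H] `&` H = [set 1%g].

(* Gamma, with the maps jA and jB, is the amalgamated free product of A and B
   along iA and iB: the pushout of groups. It is unique up to isomorphism. *)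
Record is_amalgamated_product (C A B Gamma : groupType)
    (iA : {ghom C -> A}) (iB : {ghom C -> B})
    (jA : {ghom A -> Gamma}) (jB : {ghom B -> Gamma}) : Prop := {
  amalgam_comm : forall c, jA (iA c) = jB (iB c);
  amalgam_univ : forall (H : groupType) (f : {ghom A -> H}) (g : {ghom B -> H}),
    (forall c, f (iA c) = g (iB c)) ->
    exists h : {ghom Gamma -> H},
      [/\ forall a, h (jA a) = f a, forall b, h (jB b) = g b &
          forall h' : {ghom Gamma -> H},
            (forall a, h' (jA a) = f a) -> (forall b, h' (jB b) = g b) ->
            forall x, h' x = h x]
}.

(* Main.v *)
(** Hyperbolicity is tested with discrete contour integrals. For integer-valued
    Lipschitz functions [x], [y] on a group and a closed word [w], the integral
    of [x dy] along [w] is a lower bound, up to a constant, for the area of any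
    filling of [w]; a group is hyperbolic if and only if these integrals are
    bounded linearly in the length of [w].

    From hyperbolicity to the bound: Dehn's algorithm, since a closed word that
    is locally geodesic is empty. Conversely, let [q] be the point of a geodesic
    [s, q] nearest to [r] and let [t] be a geodesic from [s] to [r]. The path
    [s, q] followed by [q, r] is quasi-geodesic; with [x = max(0, D - d(., t))]
    and [y = d(s, .)] the integral along an excursion of this path out of the
    [D]-neighbourhood of [t], closed up along [t], grows like [D] times its
    shadow on [t], so excursions are short, [q] is close to [t], and projecting
    two points to a geodesic gives the four-point inequality.

    For the amalgam, a closed word is rewritten inside [A] and inside [B]: letters
    of [A] are shortened locally or pushed into neighbouring [B]-words through
    [C], and a [B]-word lying in [C] which is short in [A] is moved to [A]. Each
    step changes the integral by an amount that the decrease of a potential, linear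
    in the length, pays for; only closed words of [B] need the linear bound. In an
    irreducible list the parts that lie in [A] are broken geodesics of the
    hyperbolic group [A] with small Gromov products at the corners (by
    quasi-convexity and malnormality of [C]), hence do not lie in [C], and the
    normal form theorem shows that the word is not trivial unless it is empty. *)
Require Import Defs.
From HB Require Import structures.
From mathcomp Require Import all_boot all_order all_algebra.
From mathcomp Require Import boolp classical_sets.
From mathcomp Require Import zify ring lra.
Set Implicit Arguments.
Unset Strict Implicit.
Unset Printing Implicit Defensive.
Import Order.TTheory GRing.Theory Num.Theory.
Local Open Scope group_scope.

(** * Word metrics *)

(* Rewriting with the library's [mulgA] and [invgM] leaves unreduced structure
   instances that later rewrites fail to match. *)
Lemma gmulgA (G : groupType) (x y z : G) : x * (y * z) = x * y * z.
Proof. exact: mulgA. Qed.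

Lemma ginvgM (G : groupType) (x y : G) : (x * y)^-1 = y^-1 * x^-1.
Proof. exact: invgM. Qed.

Section Words.
Variables (G : groupType) (S : seq G).
Implicit Types (w : seq G) (g h : G).

Definition letter (x : G) : Prop := x \in S \/ x^-1 \in S.

Definition word_inv (w : seq G) : seq G := rev [seq x^-1 | x <- w].

Lemma letterV x : letter x -> letter x^-1.
Proof. by rewrite /letter invgK => -[]; [right | left]. Qed.

Lemma word_nil : word S [::].
Proof. by []. Qed.

Lemma word_cons x w : word S (x :: w) <-> letter x /\ word S w.
Proof.
split=> [ww | [lx ww] z]; last by rewrite inE => /predU1P[-> | /ww].
by split=> [|z zw]; apply: ww; rewrite inE ?eqxx ?zw ?orbT.
Qed.

Lemma word_cat w1 w2 : word S (w1 ++ w2) <-> word S w1 /\ word S w2.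
Proof.
elim: w1 => [|x w1 IH] /=; first by split=> [|[]].
by rewrite !word_cons IH; tauto.
Qed.

Lemma word_take n w : word S w -> word S (take n w).
Proof. by rewrite -{1}(cat_take_drop n w) word_cat => -[]. Qed.

Lemma word_drop n w : word S w -> word S (drop n w).
Proof. by rewrite -{1}(cat_take_drop n w) word_cat => -[]. Qed.

Arguments word_take n [w] _.
Arguments word_drop n [w] _.

Lemma value_nil : word_value [::] = 1 :> G.
Proof. by rewrite /word_value big_nil. Qed.

Lemma value_cons x w : word_value (x :: w) = x * word_value w.
Proof. by rewrite /word_value big_cons. Qed.

Lemma value_cat w1 w2 : word_value (w1 ++ w2) = word_value w1 * word_value w2.
Proof. by rewrite /word_value big_cat. Qed.

Lemma size_word_inv w : size (word_inv w) = size w.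
Proof. by rewrite size_rev size_map. Qed.

Lemma word_word_inv w : word S w -> word S (word_inv w).
Proof.
by move=> ww x; rewrite mem_rev => /mapP[y /ww ly ->]; apply: letterV.
Qed.

Lemma value_word_inv w : word_value (word_inv w) = (word_value w)^-1.
Proof.
elim: w => [|x w IH]; first by rewrite value_nil invg1.
rewrite /word_inv /= rev_cons -cats1 value_cat !value_cons value_nil mulg1.
by rewrite ginvgM -IH.
Qed.

Hypothesis genS : generates S.
Notation len := (word_length S).
Notation d := (word_dist S).

Lemma geodesic_word g :
  exists w, [/\ word S w, word_value w = g & size w = len g].
Proof.
rewrite /word_length; case: pselect => [ex|[]].
  by case: ex_minnP => n /asboolP[w []]; exists w.
by have [w ww vw] := genS g; exists (size w); apply/asboolP; exists w.
Qed.

Lemma len_le w : word S w -> len (word_value w) <= size w.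
Proof.
move=> ww; rewrite /word_length; case: pselect => [ex|//].
case: ex_minnP => n _; apply; apply/asboolP; by exists w.
Qed.

Lemma len1 : len 1 = 0.
Proof. by apply/eqP; rewrite -leqn0 -value_nil; apply: (len_le word_nil). Qed.

Lemma lenM g h : len (g * h) <= len g + len h.
Proof.
have [w [ww <- <-]] := geodesic_word g; have [w' [ww' <- <-]] := geodesic_word h.
by rewrite -value_cat -size_cat len_le // word_cat.
Qed.

Lemma lenV_le g : len g^-1 <= len g.
Proof.
have [w [ww <- <-]] := geodesic_word g.
by rewrite -value_word_inv -(size_word_inv w); apply/len_le/word_word_inv.
Qed.

Lemma lenV g : len g^-1 = len g.
Proof. by apply/eqP; rewrite eqn_leq lenV_le -{1}(invgK g) lenV_le. Qed.

Lemma len_letter x : letter x -> len x <= 1.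
Proof.
move=> lx; have ww : word S [:: x] by rewrite word_cons.
by have := len_le ww; rewrite value_cons value_nil mulg1.
Qed.

Lemma distE g h : d g h = len (g^-1 * h).
Proof. by []. Qed.

Lemma distC g h : d g h = d h g.
Proof. by rewrite /word_dist -lenV ginvgM invgK. Qed.

Lemma dist_tri h g k : d g k <= d g h + d h k.
Proof.
have -> : d g k = len (g^-1 * h * (h^-1 * k)) by rewrite -gmulgA mulVKg.
exact: lenM.
Qed.

Lemma distM k g h : d (k * g) (k * h) = d g h.
Proof. by rewrite /word_dist ginvgM -gmulgA mulKg. Qed.

Lemma distMl g h : d g (g * h) = len h.
Proof. by rewrite /word_dist mulKg. Qed.

Lemma dist1 g : d 1 g = len g.
Proof. by rewrite /word_dist invg1 mul1g. Qed.

Lemma distxx g : d g g = 0.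
Proof. by rewrite /word_dist mulVg len1. Qed.

Lemma len_geodesic_take w n : word S w -> size w = len (word_value w) ->
  n <= size w -> len (word_value (take n w)) = n.
Proof.
move=> ww gw nw; apply/eqP; rewrite eqn_leq; apply/andP; split.
  by rewrite -[leqRHS](size_takel nw); apply/len_le/word_take.
have := lenM (word_value (take n w)) (word_value (drop n w)).
rewrite -value_cat cat_take_drop -gw.
have := len_le (word_drop n ww); rewrite size_drop; lia.
Qed.

Lemma dist_geodesic_take w i j : word S w -> size w = len (word_value w) ->
  i <= j <= size w ->
  d (word_value (take i w)) (word_value (take j w)) = j - i.
Proof.
move=> ww gw /andP[ij jw].
have e : take j w = take i w ++ drop i (take j w).
  by rewrite -{1}(cat_take_drop i (take j w)) take_takel.
have gj := len_geodesic_take ww gw jw.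
have gi := len_geodesic_take ww gw (leq_trans ij jw).
rewrite e value_cat distMl; apply/eqP; rewrite eqn_leq; apply/andP; split.
  have := len_le (word_drop i (word_take j ww)).
  by rewrite size_drop size_takel.
have := lenM (word_value (take i w)) (word_value (drop i (take j w))).
rewrite -value_cat -e gj gi; lia.
Qed.

Lemma geodesic_path g : exists p,
  [/\ geodesic S (len g) p, p 0 = 1 & p (len g) = g].
Proof.
have [w [ww vw sw]] := geodesic_word g.
exists (fun i => word_value (take i w)); split; rewrite ?take0 ?value_nil //.
  by move=> i j; rewrite -sw; apply: dist_geodesic_take; rewrite // vw.
by rewrite -sw take_size.
Qed.

(** The inequality between Gromov products, doubled and with its common terms cancelled, so that it
    lives in the natural numbers. *)
Definition four_point (D : nat) : Prop := forall x y z w : G,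
  d x y + d z w <= maxn (d x z + d y w) (d x w + d y z) + D.

Lemma hyperbolic_four_point :
  gromov_hyperbolic_metric S <-> exists D, four_point D.
Proof.
split=> [[delta hyp] | [D hD]].
  exists `|Num.ceil (2%:R * delta)|%N => x y z w.
  set D := `|_|%N; have leD : (2%:R * delta <= D%:R :> rat)%R.
    apply: le_trans (Num.Theory.ceil_ge _) _.
    by rewrite -[D%:R%R]/(D%:Z%:~R)%R ler_int /D abszE ler_norm.
  have := hyp x y z w; rewrite /gromov_product /Num.min.
  rewrite (distC z y); case: ifP => _ h; rewrite addn_maxl leq_max; apply/orP.
    by left; rewrite -(ler_nat rat) !natrD; lra.
  by right; rewrite -(ler_nat rat) !natrD; lra.
exists D%:R%R => x y z w; have := hD x y z w; have := ler0n rat D.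
rewrite addn_maxl leq_max -!(ler_nat rat) !natrD /gromov_product /Num.min.
rewrite (distC z y) => D0 /orP[h | h]; case: ifP => [|/negbT]; rewrite -?leNgt; lra.
Qed.

(** The unit pads shorter words, so that [ball n] also contains the elements of length below [n]. *)
Definition letters : seq G := 1 :: S ++ [seq s^-1 | s <- S].

Fixpoint ball n : seq G :=
  if n is n'.+1 then
    [seq x * y | x <- letters, y <- ball n'] else [:: 1].

Lemma mem_ball g n : len g <= n -> g \in ball n.
Proof.
have [w [ww <- <-]] := geodesic_word g.
elim: n w ww => [|n IH] [|x w] // ww nw; rewrite ?value_nil ?inE ?eqxx //;
  rewrite -[ball _]/[seq x * y | x <- letters, y <- ball n].
  apply/allpairsP; exists (1, 1); rewrite /= mulg1 mem_head; split=> //.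
  by rewrite -value_nil; apply: IH.
rewrite value_cons; move: ww => /word_cons[lx ww].
apply/allpairsP; exists (x, word_value w); split=> //=; last exact: IH.
rewrite inE mem_cat; case: lx => [->|xS]; rewrite ?orbT //.
by rewrite -(invgK x) map_f ?orbT.
Qed.

End Words.

(** * Contour integrals *)

Section Integral.
Variables (G : groupType) (S : seq G).
Implicit Types (x y f : G -> int) (w : seq G) (g h : G).

Definition lipschitz (p : nat) (f : G -> int) : Prop :=
  forall g s, s \in S -> (`|f (g * s)%g - f g| <= p%:Z)%R.

(** A Riemann sum of [x dy] along the path that reads [w] from [g]. As [x] is taken at the start of
    each edge, reversing a path does not exactly change the sign. *)
Fixpoint integral (x y : G -> int) (g : G) (w : seq G) : int :=
  if w is s :: w' then
    (x g * (y (g * s)%g - y g) + integral x y (g * s)%g w')%R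
  else 0%R.

Lemma lipschitz_letter p f g s :
  lipschitz p f -> letter S s -> (`|f (g * s)%g - f g| <= p%:Z)%R.
Proof.
move=> lf [/lf//|sS]; have := lf (g * s) _ sS.
by rewrite -gmulgA mulgV mulg1 distrC.
Qed.

Lemma lipschitz_word p f g w : lipschitz p f -> word S w ->
  (`|f (g * word_value w)%g - f g| <= (p * size w)%:Z)%R.
Proof.
move=> lf; elim: w g => [|s w IH] g ww.
  by rewrite value_nil mulg1 subrr normr0.
move: ww => /word_cons[ls ww]; rewrite value_cons gmulgA /=.
have := IH (g * s) ww; have := lipschitz_letter g lf ls.
by rewrite mulnS PoszD; move: (f (g * s * _)) (f (g * s)); lia.
Qed.

Lemma integral_cat x y g w1 w2 : integral x y g (w1 ++ w2) =
  (integral x y g w1 + integral x y (g * word_value w1)%g w2)%R.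
Proof.
elim: w1 g => [|s w IH] g /=; first by rewrite value_nil mulg1 add0r.
by rewrite IH value_cons gmulgA addrA.
Qed.

(** Along the path [x] deviates from [x g] by at most [p * size w], and the total variation of [y]
    is at most [p * size w]; for constant [x] the sum telescopes. *)
Lemma integral_defect p x y g w :
  lipschitz p x -> lipschitz p y -> word S w ->
  (`|integral x y g w - x g * (y (g * word_value w)%g - y g)|
     <= ((p * size w) ^ 2)%:Z)%R.
Proof.
move=> lx ly; elim: w g => [|s w IH] g ww.
  by rewrite value_nil mulg1 subrr mulr0 subrr normr0.
move: ww => /word_cons[ls ww]; rewrite value_cons gmulgA /=.
have := IH (g * s) ww; have := lipschitz_letter g lx ls.
have := lipschitz_word (g * s) ly ww.
set a := x (g * s); set b := x g; set i := integral _ _ _ _.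
set u := y (g * s * word_value w); set v := y (g * s); set n := size w => h1 h2 h3.
have h4 : (`|(a - b) * (u - v)| <= p%:Z * (p * n)%:Z)%R.
  by rewrite normrM ler_pM.
have -> : (b * (v - y g) + i - b * (u - y g) =
  (i - a * (u - v)) + (a - b) * (u - v))%R by ring.
apply: le_trans (ler_normD _ _) _; apply: le_trans (lerD h3 h4) _.
by rewrite -PoszM -PoszD lez_nat; nia.
Qed.

Definition linear_integrals : Prop := forall p : nat, exists K : nat,
  forall x y, lipschitz p x -> lipschitz p y ->
  forall g w, word S w -> word_value w = 1 ->
  (`|integral x y g w| <= (K * size w)%:Z)%R.

(* A closed word and its inverse are integrated separately, so the bound for
   closed words controls an arbitrary word by a short one of the same value. *)
Lemma linear_integral_defect p K x y g w w' :
  (forall g w, word S w -> word_value w = 1 ->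
    (`|integral x y g w| <= (K * size w)%:Z)%R) ->
  lipschitz p x -> lipschitz p y -> word S w -> word S w' ->
  word_value w = word_value w' ->
  (`|integral x y g w - x g * (y (g * word_value w)%g - y g)|
     <= (K * (size w + size w') + 2 * (p * size w') ^ 2)%:Z)%R.
Proof.
move=> hK lx ly ww ww' vw.
have wi := word_word_inv ww'.
have := hK g (w ++ word_inv w'); rewrite word_cat value_cat value_word_inv.
rewrite vw mulgV size_cat size_word_inv integral_cat vw => /(_ (conj ww wi) erefl).
set h := g * word_value w'.
have := integral_defect h lx ly wi.
rewrite value_word_inv size_word_inv {2}/h -gmulgA mulgV mulg1.
set i := integral _ _ h _; set j := integral _ _ g w.
have := lipschitz_word g lx ww'; have := lipschitz_word g ly ww'.
rewrite -/h; move: (size w) (size w') => m n h1 h2 h3 h4.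
(* The way back along [w'] starts at [h], so its integral is compared with a multiple of [x h];
   passing to [x g] costs this product. *)
have h5 : (`|(x h - x g) * (y g - y h)| <= ((p * n) ^ 2)%:Z)%R.
  by rewrite normrM expnS expn1 PoszM ler_pM // distrC.
have -> : (j - x g * (y h - y g) = j + i - (i - x h * (y g - y h)) +
   - ((x h - x g) * (y g - y h)))%R by ring.
apply: le_trans (ler_normD _ _) _; rewrite normrN.
apply: le_trans (lerD (ler_normB _ _) h5) _.
by lia.
Qed.

End Integral.

Section Morphism.
Variables (G H : groupType) (j : {ghom G -> H}).

Lemma gmulf_word_value w : j (word_value w) = word_value (map j w).
Proof. by rewrite /word_value gmulf_prod big_map. Qed.

Lemma word_map S S' w : (forall s, s \in S -> j s \in S') ->
  word S w -> word S' (map j w).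
Proof.
move=> sub ww x /mapP[s /ww[/sub sS|/sub sS] ->]; first by left.
by right; rewrite -gmulfV.
Qed.

Lemma lipschitz_comp S S' p f g : (forall s, s \in S -> j s \in S') ->
  lipschitz S' p f -> lipschitz S p (fun h => f (g * j h)).
Proof. by move=> sub lf h s /sub sS; rewrite gmulfM gmulgA; apply: lf. Qed.

Lemma integral_comp x y g h w : integral x y (g * j h) (map j w) =
  integral (fun h => x (g * j h)) (fun h => y (g * j h)) h w.
Proof. by elim: w h => //= s w IH h; rewrite -IH !gmulfM !gmulgA. Qed.

End Morphism.

(** Each letter over [S'] is replaced by a geodesic word over [S], of length at most [M']. Functions
    that are [p]-Lipschitz for [S'] are [p * M]-Lipschitz for [S], so one replacement changes the
    integral by at most [(p * M * M') ^ 2]. *)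
Lemma linear_integrals_generators (G : groupType) (S S' : seq G) :
  generates S -> generates S' -> linear_integrals S -> linear_integrals S'.
Proof.
move=> gS gS' LI p.
pose M := \max_(s <- S) word_length S' s.
pose M' := \max_(s <- S') word_length S s.
have lip f : lipschitz S' p f -> lipschitz S (p * M) f.
  move=> lf g s sS; have [w [ww vw sw]] := geodesic_word gS' s.
  have := lipschitz_word g lf ww; rewrite vw => /le_trans; apply.
  rewrite sw lez_nat leq_mul2l; apply/orP; right.
  exact: (leq_bigmax_seq (F := word_length S')).
have [K hK] := LI (p * M)%N; exists (K * M' + (p * M * M') ^ 2)%N => x y.
move=> /lip lx /lip ly g w ww.
have sub : exists w', [/\ word S w', word_value w' = word_value w,
    size w' <= (M' * size w)%N &
    (`|integral x y g w - integral x y g w'| <=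
      ((p * M * M') ^ 2 * size w)%:Z)%R].
  elim: w g ww => [|s w IH] g ww; first by exists [::]; rewrite subrr.
  move: ww => /word_cons[ls ww].
  have [w' [ww' vw' sw' iw']] := IH (g * s) ww.
  have [u [wu vu su]] := geodesic_word gS s.
  have {}su : size u <= M'.
    rewrite su; case: ls => sS; last rewrite -(lenV gS);
      exact: (leq_bigmax_seq (F := word_length S)).
  exists (u ++ w'); split.
  - by rewrite word_cat.
  - by rewrite value_cat vu value_cons vw'.
  - by rewrite size_cat /= mulnS leq_add.
  rewrite integral_cat vu /=.
  have := integral_defect g lx ly wu; rewrite vu.
  set I1 := integral _ _ g u; set c := (x g * _)%R => h1.
  have le2 : ((p * M * size u) ^ 2 <= (p * M * M') ^ 2)%N.
    by rewrite leq_exp2r // leq_mul2l su orbT.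
  have -> : (c + integral x y (g * s)%g w - (I1 + integral x y (g * s)%g w')
    = (integral x y (g * s)%g w - integral x y (g * s)%g w') - (I1 - c))%R.
    by ring.
  apply: le_trans (ler_normB _ _) _; apply: le_trans (lerD iw' h1) _.
  by rewrite mulnS -PoszD lez_nat; lia.
move=> vw; have [w' [ww' vw' sw' iw']] := sub.
rewrite vw in vw'; have := hK x y lx ly g w' ww' vw'.
have -> : integral x y g w = ((integral x y g w - integral x y g w')
  + integral x y g w')%R by ring.
move=> h; apply: le_trans (ler_normD _ _) _; apply: le_trans (lerD iw' h) _.
by rewrite -PoszD lez_nat; nia.
Qed.

(** * Linear integrals imply hyperbolicity *)

Section Stays.
Variables (G : groupType).
Implicit Types (P : G -> Prop) (w : seq G) (g : G).

Fixpoint stays (P : G -> Prop) g w : Prop :=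
  P g /\ if w is s :: w' then stays P (g * s) w' else True.

Lemma stays_cat P g w1 w2 :
  stays P g (w1 ++ w2) <-> stays P g w1 /\ stays P (g * word_value w1) w2.
Proof.
elim: w1 g => [|s w IH] g /=; last by rewrite IH value_cons gmulgA; tauto.
rewrite value_nil mulg1; split=> [|[]//] h; split=> //.
by case: w2 h => [|? ?] [].
Qed.

Lemma stays_inv P g w : stays P g w -> stays P (g * word_value w) (word_inv w).
Proof.
elim: w g => [|s w IH] g [Pg sw]; rewrite ?value_nil ?mulg1 //.
rewrite /word_inv /= rev_cons -cats1 value_cons gmulgA stays_cat; split.
  exact: IH.
rewrite value_word_inv mulgK /= mulgK; split; last by [].
by case: (w) sw => [|? ?] [].
Qed.

End Stays.

Section IntegralEstimates.
Variables (G : groupType) (S : seq G) (x y : G -> int).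
Hypothesis ly : lipschitz S 1 y.
Implicit Types (w : seq G) (g : G).

Lemma integral_le (D : nat) g w : (forall v, `|x v| <= D%:Z)%R -> word S w ->
  (`|integral x y g w| <= (D * size w)%:Z)%R.
Proof.
move=> bx; elim: w g => [|s w IH] g ww //=.
move: ww => /word_cons[ls ww]; have := IH (g * s) ww.
have h : (`|x g * (y (g * s)%g - y g)| <= D%:Z * 1)%R.
  by rewrite normrM ler_pM //; apply: lipschitz_letter ls.
by move=> h'; rewrite mulnS; apply: le_trans (ler_normD _ _) _; lia.
Qed.

Lemma integral_eq0 g w :
  (forall i, i < size w -> x (g * word_value (take i w)) = 0%R) ->
  integral x y g w = 0%R.
Proof.
elim: w g => //= s w IH g h.
have := h 0 isT; rewrite value_nil mulg1 => ->; rewrite mul0r add0r.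
by apply: IH => i iw; have := h i.+1 iw; rewrite /= value_cons gmulgA.
Qed.

Lemma integral_constant c g w : stays (fun v => x v = c) g w ->
  integral x y g w = (c * (y (g * word_value w)%g - y g))%R.
Proof.
elim: w g => [|s w IH] g /= [xg sw]; first by rewrite value_nil mulg1 subrr mulr0.
by rewrite IH // value_cons gmulgA xg; ring.
Qed.

End IntegralEstimates.

(** * Corners between a geodesic and a shortest path to it *)

Section Corner.
Variables (G : groupType) (S : seq G).
Hypothesis genS : generates S.
Notation d := (word_dist S).
Notation len := (word_length S).
Notation pt w i := (word_value (take i w)).

Lemma value_take_word_inv (w : seq G) i :
  pt (word_inv w) i = (word_value w)^-1 * pt w (size w - i).
Proof.
rewrite /word_inv take_rev size_map -map_drop -[rev _]/(word_inv _).
rewrite value_word_inv; set n := size w - i.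
have -> : word_value w = pt w n * word_value (drop n w).
  by rewrite -value_cat cat_take_drop.
by rewrite ginvgM mulgVK.
Qed.

Lemma value_take_add (w : seq G) i j : pt w (i + j) = pt w i * pt (drop i w) j.
Proof. by rewrite takeD value_cat. Qed.

(** Only [i] on [u] and [j] on [v] need an argument. As the corner is nearest to the end of [v], the
    part of [v] up to [j] is no longer than the distance of the two vertices; the triangle
    inequality then bounds the part of [u] after [i] by twice this distance. *)
Lemma geodesic_corner_quasigeodesic (u v : seq G) i j :
  word S u -> word S v ->
  size u = len (word_value u) -> size v = len (word_value v) ->
  (forall i, i <= size u -> size v <= d (pt u i) (word_value (u ++ v))) ->
  i <= j <= size u + size v -> j - i <= 3 * d (pt (u ++ v) i) (pt (u ++ v) j).
Proof.
move=> wu wv gu gv near /andP[ij jn].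
have ptv k : size u <= k -> pt (u ++ v) k = word_value u * pt v (k - size u).
  move=> uk; rewrite take_cat ltnNge uk /= value_cat //.
have ptu k : k <= size u -> pt (u ++ v) k = pt u k by move=> ku; rewrite takel_cat.
have [ju|uj] := leqP j (size u).
  by rewrite !ptu ?(leq_trans ij) // dist_geodesic_take ?ij //; lia.
have [iu|ui] := leqP (size u) i.
  by rewrite !ptv ?(ltnW uj) // distM dist_geodesic_take //; lia.
have h1 := near i (ltnW ui).
have h2 := dist_tri genS (pt (u ++ v) j) (pt u i) (word_value (u ++ v)).
have h3 := dist_tri genS (pt (u ++ v) j) (pt u i) (pt u (size u)).
have h4 := dist_geodesic_take genS wu gu (i := i) (j := size u).
rewrite (ltnW ui) leqnn in h4; have {}h4 := h4 isT.
have h5 : d (pt (u ++ v) j) (word_value (u ++ v)) = size u + size v - j.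
  rewrite ptv ?(ltnW uj) // value_cat distM -{2}(take_size v).
  by rewrite dist_geodesic_take //; lia.
have h6 : d (pt (u ++ v) j) (pt u (size u)) = j - size u.
  rewrite ptv ?(ltnW uj) // take_size distC // distMl len_geodesic_take //; lia.
rewrite (ptu i (ltnW ui)).
move: h1 h2 h3 h4 h5 h6.
move: (d (pt u i) (pt (u ++ v) j)) (d (pt u i) (pt u (size u))) (d (pt u i) _).
move: (d (pt (u ++ v) j) (word_value _)) (d (pt (u ++ v) j) _).
move: (size u) (size v) ij jn uj ui; clear; lia.
Qed.

(** The path [e] runs along [t] forwards or backwards; with truncated subtraction its length is the
    absolute value of [k - l]. The integral telescopes because [x] is constant on [t]. *)
Lemma integral_along_geodesic (x y : G -> int) (c : int) (t : seq G) k l :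
  lipschitz S 1 y -> word S t -> size t = len (word_value t) ->
  (forall i, i <= size t -> x (pt t i) = c) ->
  k <= size t -> l <= size t ->
  exists e, [/\ word S e, pt t l * word_value e = pt t k,
    size e = (k - l) + (l - k) &
    integral x y (pt t l) e = (c * (y (pt t k) - y (pt t l)))%R].
Proof.
move=> ly wt gt xt kt lt.
have seg i j : i <= j <= size t ->
  [/\ word S (take (j - i) (drop i t)), pt t i * pt (drop i t) (j - i) = pt t j,
    size (take (j - i) (drop i t)) = j - i &
    stays (fun v => x v = c) (pt t i) (take (j - i) (drop i t))].
  move=> /andP[ij jt]; split.
  - exact/word_take/word_drop.
  - by rewrite -value_take_add subnKC.
  - by rewrite size_takel // size_drop; lia.
  have xd n : i + n <= size t -> x (pt t i * pt (drop i t) n) = c.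
    by move=> h; rewrite -value_take_add xt.
  have : j - i <= size (drop i t) by rewrite size_drop; lia.
  have {}xd n : n <= size (drop i t) -> x (pt t i * pt (drop i t) n) = c.
    by rewrite size_drop => h; apply: xd; lia.
  move: (j - i) (pt t i) (drop i t) xd; clear.
  elim=> [|n IH] g [|s w] xd //= nw; have := xd 0 isT;
    rewrite value_nil mulg1 => xg; split=> //.
  apply: IH => // m mw; have := xd m.+1 mw.
  by rewrite /= value_cons gmulgA.
have [kl|/ltnW lk] := leqP k l.
  have [we ve se te] := seg k l (introT andP (conj kl lt)).
  exists (word_inv (take (l - k) (drop k t))); split.
  - exact: word_word_inv.
  - by rewrite value_word_inv -ve mulgK.
  - by rewrite size_word_inv se; lia.
  have := stays_inv te; rewrite ve => /(integral_constant y) ->.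
  by rewrite value_word_inv -ve mulgK.
have [we ve se te] := seg l k (introT andP (conj lk kt)).
exists (take (k - l) (drop l t)); split=> //; first by rewrite se; lia.
by rewrite (integral_constant y te) ve.
Qed.

End Corner.

Section LinearIntegralsFourPoint.
Variables (G : groupType) (S : seq G).
Hypothesis genS : generates S.
Notation d := (word_dist S).
Notation len := (word_length S).
Notation pt w i := (word_value (take i w)).

Lemma lipschitz_len : lipschitz S 1 (fun v => Posz (len v)).
Proof.
move=> g s sS; have ls : letter S s by left.
have := lenM genS g s; have := lenM genS (g * s) s^-1.
rewrite mulgK lenV //; have := len_letter ls.
move: (len (g * s)) (len g) (len s); clear; lia.
Qed.

(* Truncated subtraction: this is [max(0, D - d(v, t))]. *)
Definition closeness (D : nat) (t : seq G) (v : G) : nat :=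
  \max_(k < (size t).+1) (D - d v (pt t k)).

Lemma closeness_le D t v : closeness D t v <= D.
Proof. by apply/bigmax_leqP => k _; rewrite leq_subr. Qed.

Lemma closeness_on D t k : k <= size t -> closeness D t (pt t k) = D.
Proof.
move=> kt; apply/eqP; rewrite eqn_leq closeness_le.
rewrite -{1}(subn0 D) -(distxx S (pt t k)).
have kt' : k < (size t).+1 by [].
exact: (leq_bigmax (F := fun i : 'I_(size t).+1 => D - d (pt t k) (pt t i))
  (Ordinal kt')).
Qed.

Lemma closeness_far D t v : (forall k, k <= size t -> D <= d v (pt t k)) ->
  closeness D t v = 0.
Proof.
move=> far; apply/eqP; rewrite -leqn0; apply/bigmax_leqP => k _.
by rewrite leqn0 subn_eq0 far // -ltnS.
Qed.

Lemma lipschitz_closeness D t : lipschitz S 1 (fun v => Posz (closeness D t v)).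
Proof.
have step v v' : d v v' <= 1 -> closeness D t v <= closeness D t v' + 1.
  move=> vv'; apply/bigmax_leqP => k _.
  have := leq_bigmax (F := fun i : 'I_(size t).+1 => D - d v' (pt t i)) k.
  rewrite -/(closeness D t v') /=.
  have := dist_tri genS v v' (pt t k); rewrite (distC genS v' v); move: vv'.
  move: (d v (pt t k)) (d v' (pt t k)) (d v v') (closeness _ _ _); clear; lia.
move=> g s sS; have ls : letter S s by left.
have e : d g (g * s) <= 1 by rewrite distMl; apply: len_letter ls.
have := step _ _ e; rewrite distC // in e; have := step _ _ e.
move: (closeness D t g) (closeness D t (g * s)); clear; lia.
Qed.

Hypothesis LI : linear_integrals S.

Lemma corner_near : exists E : nat, forall u v t : seq G,
  word S u -> word S v -> word S t ->
  size u = len (word_value u) -> size v = len (word_value v) ->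
  size t = len (word_value t) -> word_value t = word_value (u ++ v) ->
  (forall i, i <= size u -> size v <= d (pt u i) (word_value (u ++ v))) ->
  exists2 k, k <= size t & d (word_value u) (pt t k) <= E.
Proof.
have [K hK] := LI 1%N.
(* The loop built below has length at most [8 * D + 4 * q], where [q] is its shadow on [t], and its
   integral is [D * q] up to sign and a constant. Since [D] exceeds [4 * K], the linear bound forces
   [q <= M]. *)
pose D := (4 * K + 1)%N; pose M := (8 * K * D + D + 2 * D * D)%N.
exists (3 * (2 * D + M) + D)%N => u v t wu wv wt gu gv gt vt near.
pose s i := pt (u ++ v) i; pose n := size u + size v.
have wuv : word S (u ++ v) by rewrite word_cat.
have quasi i j : i <= j <= n -> j - i <= (3 * d (s i) (s j))%N.
  exact: geodesic_corner_quasigeodesic.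
pose close i := has (fun k => d (s i) (pt t k) <= D) (iota 0 (size t).+1).
have closeP i : reflect (exists2 k, k <= size t & d (s i) (pt t k) <= D) (close i).
  apply: (iffP hasP) => -[k kt dk]; exists k => //.
    by move: kt; rewrite mem_iota.
  by rewrite mem_iota.
(* The excursion goes from the last vertex of [u] close to [t] to the first vertex of [v] close to
   [t]. Both exist, since [t] has the same ends as the broken path. *)
have [|i0 /andP[i0u /closeP[k kt dk]] i0max] :=
  @ex_maxnP (fun i => (i <= size u) && close i) (size u) _ (fun i => @proj1 _ _ \o andP).
  exists 0; apply/closeP; exists 0 => //; rewrite /s !take0 distxx //.
have [|j0 /andP[/andP[uj0 j0n] /closeP[l lt dl]] j0min] :=
  @ex_minnP (fun j => (size u <= j <= n) && close j).
  exists n; rewrite leqnn leq_addr /=; apply/closeP; exists (size t) => //.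
  by rewrite /s /n -size_cat !take_size vt distxx.
pose x v := Posz (closeness D t v); pose y v := Posz (len v).
have lx : lipschitz S 1 x := lipschitz_closeness D t.
have ly : lipschitz S 1 y := lipschitz_len.
have xD v' : (`|x v'| <= D%:Z)%R by rewrite /x ger0_norm // lez_nat closeness_le.
have xt i : i <= size t -> x (pt t i) = D%:Z%R by move=> it; rewrite /x closeness_on.
have yt i : i <= size t -> y (pt t i) = i%:Z%R.
  by move=> it; rewrite /y len_geodesic_take.
have [e [we ve se ie]] := integral_along_geodesic ly wt gt xt kt lt.
rewrite !yt // in ie.
have ij : i0 <= j0 by apply: leq_trans uj0.
pose m := take (j0 - i0) (drop i0 (u ++ v)).
have wm : word S m by apply/word_take/word_drop.
have sm : size m = j0 - i0.
  by rewrite size_takel // size_drop size_cat leq_sub2r.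
have vm : s i0 * word_value m = s j0 by rewrite -value_take_add subnKC.
(* Between its ends the excursion is further than [D] from [t], where [x] vanishes, and [x] is not
   evaluated at its last vertex; so only the first edge contributes. *)
have im : (`|integral x y (s i0) m| <= D%:Z)%R.
  have : forall i, 0 < i < size m -> x (s i0 * pt m i) = 0%R.
    move=> i /andP[i_gt0]; rewrite sm => im.
    rewrite take_takel ?(ltnW im) // -value_take_add /x closeness_far //.
    move=> k' k't; apply: ltnW; rewrite ltnNge; apply/negP => dk'.
    have cl : close (i0 + i) by apply/closeP; exists k'.
    have [iu|ui] := leqP (i0 + i) (size u).
      by have := i0max (i0 + i); rewrite iu cl => /(_ isT); clear -i_gt0; lia.
    have := j0min (i0 + i); rewrite cl (ltnW ui) andbT /=.
    have : i0 + i <= n by clear -im j0n; lia.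
    by move=> -> /(_ isT); clear -im; lia.
  case: (m) wm => [|a m'] //= /word_cons[la wm'] x0.
  rewrite integral_eq0 ?addr0 => [|i im']; last first.
    by have := x0 i.+1 im'; rewrite /= value_cons gmulgA.
  rewrite normrM -[leRHS]mulr1 ler_pM //; exact: lipschitz_letter la.
have [c1 [wc1 vc1 sc1]] := geodesic_word genS ((s j0)^-1 * pt t l).
have [c2 [wc2 vc2 sc2]] := geodesic_word genS ((pt t k)^-1 * s i0).
have ic1 := integral_le ly (s j0) xD wc1.
have ic2 := integral_le ly (pt t k) xD wc2.
rewrite -distE in sc1; rewrite -distE distC // in sc2.
(* The loop follows the excursion, crosses to [t], runs along [t] and crosses back. *)
have closed : word_value (m ++ c1 ++ e ++ c2) = 1.
  apply: (mulgI (s i0)); rewrite !value_cat gmulgA vm vc1 gmulgA mulVKg gmulgA ve.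
  by rewrite vc2 mulVKg mulg1.
have wl : word S (m ++ c1 ++ e ++ c2) by rewrite !word_cat.
have ih := hK x y lx ly (s i0) _ wl closed.
rewrite !integral_cat vm vc1 mulVKg ve ie in ih.
pose q := (k - l) + (l - k).
have dlk : d (pt t l) (pt t k) <= q by rewrite /q -se -ve distMl; apply: len_le.
have dij := quasi i0 j0; rewrite ij j0n in dij; have {}dij := dij isT.
have := dist_tri genS (pt t l) (s j0) (pt t k).
have := dist_tri genS (pt t k) (s i0) (s j0).
have : d (word_value u) (s i0) = size u - i0.
  rewrite distC // /s takel_cat //.
  have := dist_geodesic_take genS wu gu (i := i0) (j := size u).
  by rewrite i0u leqnn take_size; apply.
have := dist_tri genS (s i0) (word_value u) (pt t k).
rewrite (distC genS (pt t k) (s j0)).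
move=> t1 t2 t3 t4.
have q_le : q <= M.
  have szb : size (m ++ c1 ++ e ++ c2) <= 8 * D + 4 * q.
    rewrite !size_cat sm sc1 se sc2.
    move: t3 t4 dij dlk dk dl; rewrite -/q; move: (d _ _) (d _ _) (d _ _) (d _ _).
    move: (d _ _) (j0 - i0); clear; lia.
  have qD : (D%:Z * q%:Z)%R = `|D%:Z * (k%:Z - l%:Z)|%R.
    by rewrite normrM /q; congr (_ * _)%R; clear; lia.
  have sc1' : D * size c1 <= D * D by rewrite leq_mul2l sc1 dl orbT.
  have sc2' : D * size c2 <= D * D by rewrite leq_mul2l sc2 dk orbT.
  have szb' : K * size (m ++ c1 ++ e ++ c2) <= K * (8 * D + 4 * q).
    by rewrite leq_mul2l szb orbT.
  have leDq : D * q <= D + D * D + D * D + K * (8 * D + 4 * q).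
    move: im ic1 ic2 ih qD szb' sc1' sc2'.
    move: (integral _ _ _ m) (integral _ _ _ c1) (integral _ _ _ c2).
    rewrite -PoszM; move: (D * size c1)%N (D * size c2)%N (K * size _)%N (D * q)%N.
    move: (D * D)%N (K * (8 * D + 4 * q))%N (D%:Z * (k%:Z - l%:Z))%R.
    by clear; lia.
  have eD : (D * q = 4 * (K * q) + q)%N by rewrite /D mulnDl mul1n -mulnA.
  rewrite eD mulnDr !(mulnCA K) in leDq.
  rewrite /M -!mulnA; move: leDq; move: (K * q)%N (K * D)%N (D * D)%N.
  by clear; lia.
exists k => //; move: q_le t1 t2 t3 t4 dij dlk dk dl uj0.
rewrite -/q; clearbody q; 
move: (d _ _) (d _ _) (d _ _) (d _ _) (d _ _) (d _ _) (d _ _).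
by clear -i0u; move: (size u) D M i0u; clear; lia.
Qed.

(** By [corner_near] the nearest point to [z] is close to a vertex of a geodesic from [g] to [z],
    along which distances add up. Each of the two summands on the left loses at most the constant of
    [corner_near]. *)
Lemma corner : exists E : nat, forall (t : seq G) g i z,
  word S t -> size t = len (word_value t) -> i <= size t ->
  (forall j, j <= size t -> d (g * pt t i) z <= d (g * pt t j) z) ->
  i + d (g * pt t i) z <= d g z + E.
Proof.
have [E hE] := corner_near; exists (2 * E)%N => t g i z wt gt it near.
have [v [wv vv sv]] := geodesic_word genS ((g * pt t i)^-1 * z).
have [r [wr vr sr]] := geodesic_word genS (g^-1 * z).
have vz : word_value (take i t ++ v) = g^-1 * z.
  by rewrite value_cat vv (@ginvgM G) -!(@gmulgA G) (@mulVKg G).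
have gi := len_geodesic_take genS wt gt it.
have near' j : j <= size (take i t) ->
    size v <= d (pt (take i t) j) (word_value (take i t ++ v)).
  rewrite size_takel // => ji; rewrite take_takel // vz sv -distE.
  by rewrite -(distM S g (pt t j)) mulVKg near // (leq_trans ji).
have [||||k kr dk] := hE (take i t) v r (word_take wt) wv wr _ _ _ _ near'.
- by rewrite size_takel.
- by rewrite vv.
- by rewrite vr.
- by rewrite vr vz.
have := dist_tri genS (pt r k) 1 (pt t i).
have := dist_tri genS (pt r k) (pt t i) (g^-1 * z).
rewrite !dist1 gi (len_geodesic_take genS wr _ kr) ?vr // (distC genS (pt r k) (pt t i)).
have := dist_geodesic_take genS wr _ (i := k) (j := size r).
rewrite take_size kr leqnn vr => /(_ sr isT) ->.
rewrite -(distM S g (pt t i) (g^-1 * z)) mulVKg.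
rewrite -distE in sr; rewrite sr in kr *.
by move: dk kr; move: (d _ _) (d _ _) (d _ _); clear; lia.
Qed.

(** The points [c] and [e] are projected to a geodesic from [a] to [b]. By [corner] the detour
    through a projection is nearly optimal for reaching either end, so the four points compare with
    a tree made of a segment with two branches. *)
Lemma linear_integrals_four_point : exists D, four_point S D.
Proof.
have [E hE] := corner; exists (2 * E)%N => a b c e.
have [t [wt vt st]] := geodesic_word genS (a^-1 * b).
have gt : size t = len (word_value t) by rewrite vt.
have proj z : exists i, [/\ i <= size t, i + d (a * pt t i) z <= d a z + E &
    size t - i + d (a * pt t i) z <= d b z + E].
  pose f (i : 'I_(size t).+1) := d (a * pt t i) z.
  have [i _ imin] := @arg_minnP _ ord0 xpredT f isT.
  have near j : j <= size t -> d (a * pt t i) z <= d (a * pt t j) z.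
    move=> jt; have jt' : j < (size t).+1 by [].
    exact: (imin (Ordinal jt')).
  have it : i <= size t by rewrite -ltnS.
  exists i; split=> //; first exact: hE.
  (* The estimate for [b] is [corner] on the reversed geodesic. *)
  have e1 : b * pt (word_inv t) (size t - i) = a * pt t i.
    by rewrite value_take_word_inv subKn // vt ginvgM invgK -!gmulgA mulVKg.
  rewrite -e1; apply: hE; rewrite ?size_word_inv ?leq_subr //.
  - exact: word_word_inv.
  - by rewrite value_word_inv lenV.
  move=> j jt; rewrite e1 value_take_word_inv vt ginvgM invgK -!gmulgA mulVKg.
  by apply: near; rewrite leq_subr.
have [i [it hi1 hi2]] := proj c; have [j [jt hj1 hj2]] := proj e.
rewrite (distC genS c e) in hi1 hi2 hj1 hj2 *.
have dab : d a b = size t by rewrite st.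
have dij : d (a * pt t i) (a * pt t j) <= (i - j) + (j - i).
  rewrite distM; have [ij|ji] := leqP i j.
    by rewrite dist_geodesic_take ?ij //; lia.
  by rewrite distC // dist_geodesic_take ?(ltnW ji) //; lia.
have := dist_tri genS (a * pt t i) c e.
have := dist_tri genS (a * pt t j) (a * pt t i) e.
rewrite (distC genS c (a * pt t i)) dab (distC genS e c).
move: it jt hi1 hi2 hj1 hj2 dij.
move: (d _ _) (d _ _) (d _ _) (d _ _) (d _ _) (d _ _) (d _ _) (d _ _) (d _ _).
by move: (size t); clear; lia.
Qed.

End LinearIntegralsFourPoint.

(** * Hyperbolicity implies linear integrals *)

Section Replace.
Variables (G : groupType) (S : seq G) (x y : G -> int).

Lemma integral_replace g w1 u u' w2 : word_value u = word_value u' ->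
  (integral x y g (w1 ++ u ++ w2) - integral x y g (w1 ++ u' ++ w2) =
   integral x y (g * word_value w1)%g u - integral x y (g * word_value w1)%g u')%R.
Proof. by move=> vu; rewrite !integral_cat vu; ring. Qed.

(** Both integrals are compared with the same product, the initial value of [x] times the increment
    of [y]. *)
Lemma integral_same_value p g u u' : lipschitz S p x -> lipschitz S p y ->
  word S u -> word S u' -> word_value u = word_value u' ->
  (`|integral x y g u - integral x y g u'|
     <= ((p * size u) ^ 2 + (p * size u') ^ 2)%:Z)%R.
Proof.
move=> lx ly wu wu' vu.
have := integral_defect g lx ly wu'; have := integral_defect g lx ly wu.
rewrite vu PoszD; set c := (x g * _)%R => h h'.
by apply: le_trans (ler_distD c _ _) _; rewrite (distrC c) lerD.
Qed.

End Replace.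

Section BrokenGeodesics.
Variables (G : groupType) (S : seq G) (D : nat).
Hypothesis genS : generates S.
Hypothesis hyp : four_point S D.
Notation d := (word_dist S).
Notation len := (word_length S).

(** Here [a] and [b + D] bound twice the Gromov products at the two corners of the path [h], [g],
    [t]. Of the two alternatives in the four-point condition for its vertices, a long [g] excludes
    one, and the other is the claim. The new bound does not involve [b], so it does not grow under
    iteration. *)
Lemma broken_geodesic h g t a b :
  len h + len g <= len (h * g) + a ->
  len g + len t <= len (g * t) + b + D ->
  a + b + 2 * D < 2 * len g ->
  len h + len (g * t) <= len (h * (g * t)) + a + D.
Proof.
have := hyp 1 (h * g) h (h * (g * t)).
rewrite !dist1 (distC genS (h * g) h) !distMl distM distMl.
move: (len h) (len g) (len t) (len (h * g)) (len (g * t)) (len (h * (g * t))).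
by clear; lia.
Qed.

Definition local_geodesic (r : nat) (u : seq G) : Prop :=
  forall u1 u2 u3, u = u1 ++ u2 ++ u3 -> size u2 <= r ->
  size u2 <= len (word_value u2).

Lemma local_geodesic_cat r u v :
  local_geodesic r (u ++ v) -> local_geodesic r u /\ local_geodesic r v.
Proof.
move=> h; split=> u1 u2 u3 e.
  by apply: (h u1 u2 (u3 ++ v)); rewrite e -!catA.
by apply: (h (u ++ u1) u2 u3); rewrite e -!catA.
Qed.

Lemma local_geodesic_len r u : word S u -> local_geodesic r u -> size u <= r ->
  len (word_value u) = size u.
Proof.
move=> wu lu su; apply/eqP; rewrite eqn_leq len_le //=.
by apply: (lu [::] u [::]); rewrite ?cats0.
Qed.

(* [u] is cut into pieces of length between [m] and [2 m]; consecutive pieces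
   have Gromov product 0, and [a] bounds (twice) the Gromov products of the end
   pieces with the neighbours [h] and [t] of [u]. *)
Lemma local_geodesic_extend m a u t : word S u -> local_geodesic (3 * m) u ->
  a + D < m -> m <= size u ->
  (forall u1 u2, u = u1 ++ u2 -> m <= size u2 < 2 * m ->
     len (word_value u2) + len t <= len (word_value u2 * t) + a + D) ->
  m <= len (word_value u * t) + a + D /\
  forall h, (forall u1 u2, u = u1 ++ u2 -> m <= size u1 < 2 * m ->
     len h + len (word_value u1) <= len (h * word_value u1) + a) ->
  len h + len (word_value u * t) <= len (h * (word_value u * t)) + a + D.
Proof.
move=> wu lu am mu ht; have [n] := ubnP (size u).
elim: n u wu lu mu ht => // n IH u wu lu mu ht un.
have [u2m|mu2] := ltnP (size u) (2 * m).
  have gu : len (word_value u) = size u.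
    by apply: local_geodesic_len wu lu _; clear -u2m; lia.
  have h1 := ht [::] u erefl; rewrite mu u2m in h1; have {}h1 := h1 isT.
  split=> [|h hh]; first by move: h1; rewrite gu; clear -mu; lia.
  apply: broken_geodesic h1 _; last by rewrite gu; clear -mu am; lia.
  by apply: (hh u [::]); rewrite ?cats0 // mu.
set g := take m u; set v := drop m u; have uE : u = g ++ v by rewrite cat_take_drop.
have sg : size g = m by rewrite size_takel.
have sv : size v = size u - m by rewrite size_drop.
move: wu; rewrite uE word_cat => -[wg wv].
have [lg lv] : local_geodesic (3 * m) g /\ local_geodesic (3 * m) v.
  by apply: local_geodesic_cat; rewrite -uE.
have gg : len (word_value g) = size g.
  by apply: local_geodesic_len wg lg _; rewrite sg; clear; lia.
have [|u1 u2 vE||_ hv] := IH v wv lv; try by rewrite sv; move: mu2 un am; clear; lia.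
  by apply: (ht (g ++ u1)); rewrite uE vE catA.
(* No length is lost between [g] and [v]: [g] followed by a piece of [v] shorter than [2 * m] is a
   subword shorter than [3 * m], hence geodesic. *)
have {hv}h1 : len (word_value g) + len (word_value v * t) <=
    len (word_value g * (word_value v * t)) + a + D.
  apply: hv => u1 u2 vE /andP[mu1 u1m].
  rewrite -value_cat gg (leq_trans _ (leq_addr _ _)) //.
  have le1 : len (word_value u1) <= size u1.
    by apply: len_le; move: wv; rewrite vE word_cat => -[].
  have : size (g ++ u1) <= len (word_value (g ++ u1)).
    apply: (lu [::] _ u2); first by rewrite uE vE catA.
    by rewrite size_cat sg; move: u1m; clear; lia.
  by rewrite size_cat; move: le1; clear; lia.
rewrite value_cat -gmulgA; split=> [|h hh].
  by move: h1; rewrite gg sg; clear; lia.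
apply: broken_geodesic h1 _; last by rewrite gg sg; move: am; clear; lia.
by apply: (hh g v) => //; rewrite sg; move: am; clear; lia.
Qed.

(** A word of length at least [D.+1] is cut into pieces of which consecutive ones lose nothing, so
    its value is not the unit; a shorter word is itself geodesic. *)
Lemma local_geodesic_closed u : word S u -> local_geodesic (3 * D.+1) u ->
  word_value u = 1 -> u = [::].
Proof.
move=> wu lu vu; have [short|long] := ltnP (size u) D.+1.
  have := local_geodesic_len wu lu; rewrite vu len1 => h.
  by apply/size0nil/esym/h; move: short; clear; lia.
have [|||] := local_geodesic_extend (a := 0) (t := 1) wu lu; rewrite ?add0n //.
  by move=> u1 u2 _ _; rewrite len1 mulg1; clear; lia.
by rewrite vu mulg1 len1; clear; lia.
Qed.

Lemma not_local_geodesic r u : word S u -> ~ local_geodesic r u ->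
  exists u1 u2 u3 v, [/\ u = u1 ++ u2 ++ u3, size u2 <= r, word S v &
    word_value v = word_value u2 /\ size v < size u2].
Proof.
move=> wu /existsNP[u1] /existsNP[u2] /existsNP[u3].
move=> /not_implyP[uE] /not_implyP[u2r] /negP; rewrite -ltnNge => short.
have [v [wv vv sv]] := geodesic_word genS (word_value u2).
by exists u1, u2, u3, v; split=> //; rewrite sv.
Qed.

(** Dehn's algorithm: shortening a subword of length at most [3 * D.+1] changes the integral by a
    bounded amount and removes at least one letter. *)
Lemma four_point_linear_integrals : linear_integrals S.
Proof.
move=> p; exists (2 * (p * (3 * D.+1)) ^ 2)%N => x y lx ly g w.
have [n] := ubnP (size w); elim: n w => // n IH w wn ww vw.
have [lw|/not_local_geodesic] := pselect (local_geodesic (3 * D.+1) w).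
  by rewrite (local_geodesic_closed ww lw vw) /= normr0.
move=> /(_ ww)[w1 [u [w2 [v [wE ur wv [vv sv]]]]]].
move: wn ww vw; rewrite wE !size_cat !word_cat => wn [ww1 [wu ww2]] vw.
have := IH (w1 ++ v ++ w2); rewrite !size_cat !word_cat => h.
have {h}/h : size w1 + (size v + size w2) < n by move: sv wn; clear; lia.
have h : word S w1 /\ word S v /\ word S w2 by [].
rewrite -vw !value_cat vv => /(_ h erefl) ih.
have := integral_same_value (g * word_value w1) lx ly wu wv (esym vv).
rewrite -(integral_replace _ _ _ _ w2) //.
have [] : ((p * size u) ^ 2 <= (p * (3 * D.+1)) ^ 2 /\
    (p * size v) ^ 2 <= (p * (3 * D.+1)) ^ 2)%N.
  by rewrite !leq_exp2r // !leq_mul2l ur (ltnW (leq_trans sv ur)) !orbT.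
move: ih; move: (integral _ _ _ _) (integral _ _ _ _).
move: sv; move: (size u) (size v) ((p * _) ^ 2)%N ((p * _) ^ 2)%N ((p * _) ^ 2)%N.
move: (size w1) (size w2); clear; nia.
Qed.

End BrokenGeodesics.

(** * Quasi-convex malnormal subgroups *)

Section QuasiConvex.
Variables (A : groupType) (S : seq A) (D k : nat) (H : set A).
Hypothesis genS : generates S.
Hypothesis hyp : four_point S D.
Hypothesis H1 : H 1.
Hypothesis HM : forall g h, H g -> H h -> H (g * h).
Hypothesis HV : forall g, H g -> H g^-1.
Hypothesis quasi : forall n (p : nat -> A), geodesic S n p -> H (p 0) ->
  H (p n) -> forall i, i <= n -> exists2 h, H h & word_dist S (p i) h <= k.
Notation d := (word_dist S).
Notation len := (word_length S).

Lemma quasi_convex_path c : H c -> exists r : nat -> A,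
  [/\ forall i, i <= len c -> len (r i) = i,
      forall i, i <= len c -> d (r i) c = len c - i,
      forall i j, i <= j <= len c -> d (r i) (r j) = j - i &
      forall i, i <= len c -> exists2 h, H h & d (r i) h <= k].
Proof.
move=> Hc; have [r [gr r0 rc]] := geodesic_path genS c; exists r; split=> //.
- by move=> i ic; rewrite -dist1 -r0 gr ?subn0.
- by move=> i ic; rewrite -{1}rc gr // ic leqnn.
by apply: quasi gr _ _; rewrite ?r0 ?rc.
Qed.

(** Let [t] be the Gromov product of [c^-1] and [word_value p] at the unit, rounded down. The points
    at distance [t] on the geodesics to these two elements are at most [2 * D] apart. By
    quasi-convexity the one on [p] is within [2 * D + k] of [H], and the hypothesis on prefixes
    bounds [t]. *)
Lemma gromov_product_prefix p c : word S p -> size p = len (word_value p) ->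
  (forall n h, n <= size p -> H h -> n <= len (h * word_value (take n p))) ->
  H c -> len c + len (word_value p) <= len (c * word_value p) + (4 * D + 2 * k + 3).
Proof.
move=> wp gp near Hc; have HcV := HV Hc.
have [r [rl rd _ rh]] := quasi_convex_path HcV.
set P := word_value p; pose t := (len c + len P - len (c * P))./2.
have tc : t <= len c.
  have := lenM genS c^-1 (c * P); rewrite mulKg lenV // /t.
  by move: (len c) (len P) (len _); clear; lia.
have tp : t <= size p.
  have := lenM genS (c * P) P^-1; rewrite mulgK lenV // gp /t.
  by rewrite -/P; move: (len c) (len P) (len _); clear; lia.
pose q := word_value (take t p).
have lq : len q = t by rewrite /q len_geodesic_take.
have dq : d q P = len P - t.
  have := dist_geodesic_take genS wp gp (i := t) (j := size p).
  by rewrite tp leqnn take_size gp; apply.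
have dc : d c^-1 P = len (c * P) by rewrite distE invgK.
have := hyp q c^-1 1 P; have := hyp q (r t) 1 c^-1.
rewrite !(distC genS _ 1) !dist1 lenV // in tc rl rd rh *.
have [h Hh rht] := rh t tc.
have := dist_tri genS (r t) q h.
have := near t h^-1 tp (HV Hh); rewrite -distE distC //.
rewrite (rl t tc) (rd t tc) lq dc dq.

move: rht tc tp; rewrite -/q gp -/P; have : t = (len c + len P - len (c * P))./2 by [].
move: (d _ _) (d _ _) (d _ _) (d _ _); clearbody P q t.
by move: (len c) (len P) (len (c * P)); clear; lia.
Qed.

Hypothesis mal : malnormal H.

(** For a large product, the geodesic from the unit to [c^-1] and the translate by [u] of the one to
    [c'] stay close for a long time. Sampling elements of [H] near both yields, by the pigeonhole
    principle, a nontrivial element of [H] whose conjugate by [u] lies in [H]. *)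
Lemma gromov_product_malnormal m : exists a, forall u c c', ~ H u -> len u <= m ->
  H c -> H c' -> len c + len (u * c') <= len (c * (u * c')) + a.
Proof.
(* Elements of [H] sampled on both sides are joined by an element of length at most [R]. As [N]
   bounds the number of such elements, [N.+1] samples force a repetition. *)
pose R := (m + 2 * D + 1 + 2 * k)%N; pose N := size (ball S R).
exists (2 * (m + N * (2 * k).+1) + 1)%N => u c c' Hu um Hc Hc'.
rewrite leqNgt; apply/negP => big; have HcV := HV Hc.
have [r [rl rd rr rh]] := quasi_convex_path HcV.
have [r' [rl' rd' _ rh']] := quasi_convex_path Hc'.
rewrite lenV // in rl rd rr rh.
set Y := u * c' in big.
have lY : len Y <= len c' + m.
  have := lenM genS u c'; rewrite -/Y; move: um.
  by move: (len u) (len Y) (len c'); clear; lia.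
have lcY : len c' <= len Y + m.
  have := lenM genS u^-1 Y; rewrite mulKg lenV //.
  by move: um; move: (len u) (len Y) (len c'); clear; lia.
have cXY : len c <= len (c * Y) + len Y.
  by have := lenM genS (c * Y) Y^-1; rewrite mulgK lenV.
have YXc : len Y <= len (c * Y) + len c.
  have := lenM genS c^-1 (c * Y); rewrite mulKg lenV //.
  by move: (len c) (len Y) (len _); clear; lia.
have bound i : i <= N * (2 * k).+1 -> i <= len c /\ i <= len c'.
  move: (N * _)%N big lY cXY YXc.
  by move: (len c) (len c') (len Y) (len _); clear; lia.
have near i : i <= N * (2 * k).+1 -> d (r i) (u * r' i) <= m + 2 * D + 1.
  move=> iN; have [ic ic'] := bound i iN.
  have := hyp (r i) Y 1 c^-1; have := hyp (r i) (u * r' i) u Y.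
  have := dist_tri genS 1 (r i) u.
  rewrite !(distC genS _ 1) !dist1 lenV // (rl i ic) (rd i ic).
  rewrite (distC genS Y c^-1) (distC genS (u * r' i) u) !distMl (rl' i ic').
  rewrite distM (rd' i ic') (distE S c^-1) invgK.
  move: big lY cXY YXc lcY um iN ic ic'; clearbody Y.
  move: (N * _)%N (d _ _) (d _ _) (d _ _) (len _) (len Y) (len c) (len c') (len u).
  by clear; lia.
have sel j : exists h : A * A, j <= N ->
    [/\ H h.1, H h.2, d (r (j * (2 * k).+1)%N) h.1 <= k & len (h.1^-1 * u * h.2) <= R].
  have [jN|] := leqP j N; last by exists (1, 1).
  have iN : j * (2 * k).+1 <= N * (2 * k).+1 by rewrite leq_mul2r jN orbT.
  have [ic ic'] := bound _ iN; have [h Hh dh] := rh _ ic; have [h' Hh' dh'] := rh' _ ic'.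
  exists (h, h') => _; split=> //=.
  rewrite -gmulgA -distE.
  have := dist_tri genS (r (j * (2 * k).+1)%N) h (u * h').
  have := dist_tri genS (u * r' (j * (2 * k).+1)%N) (r (j * (2 * k).+1)%N) (u * h').
  have := near _ iN; move: dh dh'; rewrite distM (distC genS h (r _)) /R.
  by move: (d _ _) (d _ _) (d _ _) (d _ _) (d _ _); clear; lia.
have [f hf] := choice sel.
pose z j := (f j).1^-1 * u * (f j).2.
have inj : {in iota 0 N.+1 &, injective z}.
  move=> j j'; rewrite !mem_iota !ltnS /= => jN j'N.
  wlog jj : j j' jN j'N / j <= j'.
    by have [h|/ltnW h] := leqP j j' => W e; [|apply/esym]; apply: W.
  rewrite /z => e; apply/eqP; rewrite eqn_leq jj leqNgt; apply/negP => jj'.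
  have [Hh Hh' dh _] := hf j jN; have [Hg Hg' dg _] := hf j' j'N.
  have e1 : u^-1 * ((f j').1 * (f j).1^-1) * u = (f j').2 * (f j).2^-1.
    rewrite -!(@gmulgA A).
    have -> : (f j).1^-1 * u = (f j').1^-1 * u * (f j').2 * (f j).2^-1.
      by rewrite -e mulgK.
    by rewrite -!(@gmulgA A) mulVKg mulKg.
  have : ([set (u^-1 * x * u)%g | x in H] `&` H)%classic
      (u^-1 * ((f j').1 * (f j).1^-1) * u).
    split; last by rewrite e1; apply/HM/HV.
    by exists ((f j').1 * (f j).1^-1) => //; apply/HM/HV.
  (* Malnormality makes the two sampled elements of [H] equal, but each is within [k] of its point
     of the geodesic, and these points are more than [2 * k] apart. *)
  rewrite mal // => /= /(congr1 (fun v => u * v * u^-1)).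
  rewrite !gmulgA mulgV mul1g mulgK mulg1 mulgV => /divg1_eq ee.
  have := bound (j' * (2 * k).+1)%N; rewrite leq_mul2r j'N orbT => /(_ isT)[ic _].
  have := rr (j * (2 * k).+1)%N (j' * (2 * k).+1)%N.
  rewrite leq_mul2r jj orbT ic => /(_ isT).
  have := dist_tri genS (f j).1 (r (j * (2 * k).+1)%N) (r (j' * (2 * k).+1)%N).
  move: dh dg; rewrite ee (distC genS (f j).1 (r _)) -mulnBl.
  move: (d _ _) (d _ _) (d _ _) jj'; clear; nia.
have := uniq_leq_size (s1 := [seq z j | j <- iota 0 N.+1]) (s2 := ball S R).
rewrite map_inj_in_uniq // iota_uniq size_map size_iota -/N ltnn => /(_ isT) absurd.
suff : false by []; apply: absurd => ? /mapP[j jN ->]; apply: mem_ball => //.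
by case: (hf j) => //; move: jN; rewrite mem_iota.
Qed.

End QuasiConvex.

(** * The normal form theorem *)

Lemma ghom_of (G H : groupType) (f : G -> H) :
  {morph f : x y / x * y} -> exists F : {ghom G -> H}, forall x, F x = f x.
Proof.
move=> fM; have f1 : f 1 = 1 by apply: (mulIg (f 1)); rewrite -fM !mul1g.
pose m := isUMagmaMorphism.Build G H f (f1, fM).
pose F : {ghom G -> H} := HB.pack_for (UMagmaMorphism.type G H) f m.
by exists F.
Qed.

(** * Subgroups as groups *)

Section Subgroup.
Variables (G : groupType) (P : {pred G}) (clP : group_closed P).

(** The closure proof is a parameter of the type, so that the group structure can be inferred from
    the type. *)
Record subgroup_of (cl : group_closed P) := Subgroup {
  subgroup_val : G; _ : subgroup_val \in P }.
Notation sg := (subgroup_of clP).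

HB.instance Definition _ := [isSub of sg for @subgroup_val clP].
HB.instance Definition _ := [Choice of sg by <:].
HB.instance Definition _ := SubChoice_isSubGroup.Build G P sg clP.

Lemma ghom_corestrict (H : groupType) (f : {ghom H -> G}) :
  (forall x, f x \in P) ->
  exists F : {ghom H -> sg}, forall x, val (F x) = f x.
Proof.
move=> fP; have [|F hF] := @ghom_of H sg (fun x => Sub (f x) (fP x)).
  by move=> x y; apply/val_inj; rewrite valM !SubK gmulfM.
by exists F => x; rewrite hF SubK.
Qed.

Lemma ghom_subgroup_val : exists F : {ghom sg -> G}, forall x, F x = val x.
Proof. by apply: ghom_of => x y; rewrite valM. Qed.

End Subgroup.

(** * Permutation groups of arbitrary types *)

Section Bijections.
Variable X : Type.

Record bijection := Bijection {
  bij_fun :> X -> X; bij_inv : X -> X;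
  bij_funK : cancel bij_fun bij_inv; bij_invK : cancel bij_inv bij_fun }.

HB.instance Definition _ := gen_eqMixin bijection.
HB.instance Definition _ := gen_choiceMixin bijection.

Lemma bijection_ext (f g : bijection) : bij_fun f =1 bij_fun g -> f = g.
Proof.
case: f g => [f f' fK f'K] [g g' gK g'K] /= /funext fg; subst g.
have e : f' = g' by apply: funext => x; rewrite -{2}(f'K x) gK.
by subst g'; congr Bijection; apply: Prop_irrelevance.
Qed.

Definition bij_one : bijection := @Bijection id id (frefl _) (frefl _).
Definition bij_opp (f : bijection) : bijection :=
  Bijection (@bij_invK f) (@bij_funK f).
Definition bij_mul (f g : bijection) : bijection :=
  Bijection (can_comp (@bij_funK f) (@bij_funK g))
    (can_comp (@bij_invK g) (@bij_invK f)).

Lemma bij_mulA : associative bij_mul.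
Proof. by move=> f g h; apply: bijection_ext. Qed.
Lemma bij_mul1 : left_id bij_one bij_mul.
Proof. by move=> f; apply: bijection_ext. Qed.
Lemma bij_mulr1 : right_id bij_one bij_mul.
Proof. by move=> f; apply: bijection_ext. Qed.
Lemma bij_mulV : left_inverse bij_one bij_opp bij_mul.
Proof. by move=> f; apply: bijection_ext => x /=; apply: bij_funK. Qed.
Lemma bij_mulrV : right_inverse bij_one bij_opp bij_mul.
Proof. by move=> f; apply: bijection_ext => x /=; apply: bij_invK. Qed.

HB.instance Definition _ := isGroup.Build bijection
  bij_mulA bij_mul1 bij_mulr1 bij_mulV bij_mulrV.

Lemma ghom_of_action (G : groupType) (act : G -> X -> X) :
  (forall x, act 1 x = x) -> (forall g h x, act (g * h) x = act g (act h x)) ->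
  exists F : {ghom G -> bijection}, forall g x, F g x = act g x.
Proof.
move=> act1 actM.
have actK g : cancel (act g) (act g^-1) by move=> x; rewrite -actM mulVg act1.
have actVK g : cancel (act g^-1) (act g) by move=> x; rewrite -actM mulgV act1.
have [|F hF] := @ghom_of G bijection (fun g => Bijection (actK g) (actVK g)).
  by move=> g h; apply: bijection_ext => x /=; apply: actM.
by exists F => g x; rewrite hF.
Qed.

End Bijections.

Section Side.
Variables (C G : groupType) (i : {ghom C -> G}).
Hypothesis inj_i : injective i.

(** The representative is chosen from a set that depends only on the coset, hence is invariant under
    left translation by [C]. The second condition on this set makes the unit the representative of
    [C] itself. *)
Lemma coset_decomposition : exists dec : G -> C * G,
  [/\ forall g, i (dec g).1 * (dec g).2 = g,
      forall c g, dec (i c * g) = (c * (dec g).1, (dec g).2) &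
      dec 1 = (1, 1)].
Proof.
pose coset g : set G := fun h => (exists c, h = i c * g) /\
  ((exists c, g = i c) -> h = 1).
pose rep g := xget 1 (coset g).
have repP g : coset g (rep g).
  apply: xgetPex; have [[c gc]|nc] := pselect (exists c, g = i c).
    by exists 1; split=> //; exists c^-1; rewrite gc -gmulfM mulVg gmulf1.
  by exists g; split=> //; exists 1; rewrite gmulf1 mul1g.
have repM c g : rep (i c * g) = rep g.
  rewrite /rep; congr xget; apply/seteqP; split=> h [[c' hc] h1]; split.
  - by exists (c' * c); rewrite hc gmulfM gmulgA.
  - by move=> [c'' gc]; apply: h1; exists (c * c''); rewrite gc gmulfM.
  - by exists (c' * c^-1); rewrite hc gmulfM -gmulgA gmulfV mulKg.
  - by move=> [c'' gc]; apply: h1; exists (c^-1 * c''); rewrite gmulfM -gc gmulfV mulKg.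
have [f hf] := choice (fun g => (repP g).1).
have fg g : i (f g)^-1 * rep g = g by rewrite hf gmulfV mulKg.
exists (fun g => ((f g)^-1, rep g)); split=> //= [c g|].
  rewrite repM; congr pair; apply: inj_i; apply: (mulIg (rep g)).
  by rewrite -{1}(repM c) fg gmulfM -gmulgA fg.
have r1 : rep 1 = 1 by apply: (repP 1).2; exists 1; rewrite gmulf1.
rewrite r1; congr pair; apply: inj_i.
by have := fg 1; rewrite r1 mulg1 gmulf1.
Qed.

End Side.

(* A normal form [c t_1 ... t_n] is a pair [(c, [:: t_1; ...; t_n])]. The factor
   [G] acts on it through the bijection [normal_split] with pairs [(g, l)] where
   [l] does not start in [G]. *)
Section SideAction.
Variables (C G : groupType) (i : {ghom C -> G}) (dec : G -> C * G).
Hypothesis decK : forall g, i (dec g).1 * (dec g).2 = g.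
Hypothesis decM : forall c g, dec (i c * g) = (c * (dec g).1, (dec g).2).
Hypothesis dec1 : dec 1 = (1, 1).
Variables (T : Type) (inj : G -> T) (prj : T -> option G).
Hypothesis injK : pcancel inj prj.
Variable V : seq T -> Prop.

Definition starts (l : seq T) : bool := if l is s :: _ then prj s != None else false.

Hypothesis V_starts : forall l, V l -> starts l ->
  exists t l', [/\ l = inj t :: l', t <> 1, dec t = (1, t) & V l' /\ ~~ starts l'].
Hypothesis V_cons : forall t l, V l -> ~~ starts l -> t <> 1 -> dec t = (1, t) ->
  V (inj t :: l).

Definition normal_split (x : C * seq T) : G * seq T :=
  if x.2 is s :: l then
    if prj s is Some t then (i x.1 * t, l) else (i x.1, x.2)
  else (i x.1, x.2).

Definition normal_join (y : G * seq T) : C * seq T :=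
  let: (c, t) := dec y.1 in (c, if t == 1 then y.2 else inj t :: y.2).

Definition normal_act (g : G) (x : C * seq T) : C * seq T :=
  normal_join (g * (normal_split x).1, (normal_split x).2).

Lemma dec_rep g : dec (dec g).2 = (1, (dec g).2).
Proof.
have := decM (dec g).1 (dec g).2; rewrite decK.
case: (dec g) => c t /= [e1 e2].
rewrite [dec t]surjective_pairing -e2; congr pair.
by apply: (mulgI c); rewrite mulg1 -e1.
Qed.

Lemma normal_split_notstarts c l : ~~ starts l -> normal_split (c, l) = (i c, l).
Proof. by case: l => [|s l] //=; rewrite /normal_split /=; case: prj. Qed.

Lemma normal_split_cons c t l : normal_split (c, inj t :: l) = (i c * t, l).
Proof. by rewrite /normal_split /= injK. Qed.

Lemma V_normal_split c l : V l ->
  V (normal_split (c, l)).2 /\ ~~ starts (normal_split (c, l)).2.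
Proof.
move=> Vl; have [sl|sl] := boolP (starts l); last by rewrite normal_split_notstarts.
by have [t [l' [-> _ _ ?]]] := V_starts Vl sl; rewrite normal_split_cons.
Qed.

Lemma V_normal_join g l : V l -> ~~ starts l -> V (normal_join (g, l)).2.
Proof.
move=> Vl sl; rewrite /normal_join /=; have := dec_rep g; case: (dec g) => c t /= dt.
by case: eqP => // t1; apply: V_cons.
Qed.

Lemma V_normal_act g x : V x.2 -> V (normal_act g x).2.
Proof.
by case: x => c l /= Vl; have [V' s'] := V_normal_split c Vl; apply: V_normal_join.
Qed.

Lemma normal_splitK x : V x.2 -> normal_join (normal_split x) = x.
Proof.
case: x => c l /= Vl; have [sl|sl] := boolP (starts l).
  have [t [l' [-> t1 dt _]]] := V_starts Vl sl; rewrite normal_split_cons.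
  by rewrite /normal_join /= decM dt /= mulg1; case: eqP.
by rewrite normal_split_notstarts // /normal_join /= -[i c]mulg1 decM dec1 mulg1 eqxx.
Qed.

Lemma normal_joinK g l : ~~ starts l -> normal_split (normal_join (g, l)) = (g, l).
Proof.
move=> sl; rewrite /normal_join /=; have := decK g; case: (dec g) => c t /= <-.
by case: eqP => [->|_]; rewrite ?normal_split_cons // normal_split_notstarts // mulg1.
Qed.

Lemma normal_act1 x : V x.2 -> normal_act 1 x = x.
Proof. by move=> Vx; rewrite /normal_act mul1g -surjective_pairing normal_splitK. Qed.

Lemma normal_actM g h x : V x.2 ->
  normal_act (g * h) x = normal_act g (normal_act h x).
Proof.
case: x => c l /= Vl; have [_ s'] := V_normal_split c Vl.
by rewrite {2 3}/normal_act normal_joinK //= gmulgA.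
Qed.

(** The right-hand side does not mention the factor, so the two actions agree on [C], as the
    universal property requires. *)
Lemma normal_act_base c0 c l : V l -> normal_act (i c0) (c, l) = (c0 * c, l).
Proof.
move=> Vl; rewrite -[RHS]normal_splitK //; congr normal_join.
rewrite /normal_split /=; case: l Vl => [|s l] _; rewrite /= ?gmulfM //.
by case: prj => [t|]; rewrite /= ?gmulfM ?gmulgA.
Qed.

Lemma normal_act_starts g c l : V l -> ~~ starts l -> ~ (exists c', g = i c') ->
  starts (normal_act g (c, l)).2.
Proof.
move=> Vl sl gC; rewrite /normal_act normal_split_notstarts // /normal_join /=.
have := decK (g * i c); case: (dec _) => c' t /= e.
case: eqP => [t1|_] /=; last by rewrite injK.
case: gC; exists (c' * c^-1); rewrite gmulfM gmulfV.
by apply: (mulIg (i c)); rewrite mulgVK -e t1 mulg1.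
Qed.

End SideAction.

(** What is kept of the normal form theorem: [aa_inA] and [aa_inB] hold of the normal forms that
    start with a representative from [A] or from [B], [aa_base] is the empty one, and [aa_actA] and
    [aa_actB] are the ping-pong conditions. *)
Record alternating_action (A B C Gamma : groupType)
    (iA : {ghom C -> A}) (iB : {ghom C -> B})
    (jA : {ghom A -> Gamma}) (jB : {ghom B -> Gamma}) := AlternatingAction {
  aa_space : Type;
  aa_act : Gamma -> aa_space -> aa_space;
  aa_base : aa_space;
  aa_inA : pred aa_space;
  aa_inB : pred aa_space;
  aa_act1 : forall x, aa_act 1 x = x;
  aa_actM : forall g h x, aa_act (g * h) x = aa_act g (aa_act h x);
  aa_baseN : ~~ aa_inA aa_base /\ ~~ aa_inB aa_base;
  aa_disj : forall x, aa_inA x -> ~~ aa_inB x;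
  aa_actA : forall a x, ~~ aa_inA x -> ~ (exists c, a = iA c) ->
    aa_inA (aa_act (jA a) x);
  aa_actB : forall b x, ~~ aa_inB x -> ~ (exists c, b = iB c) ->
    aa_inB (aa_act (jB b) x);
  aa_actC : forall c x, aa_inA (aa_act (jA (iA c)) x) = aa_inA x /\
    aa_inB (aa_act (jA (iA c)) x) = aa_inB x;
  aa_freeC : forall c, aa_act (jA (iA c)) aa_base = aa_base -> c = 1 }.

Section Amalgam.
Variables (A B C Gamma : groupType).
Variables (iA : {ghom C -> A}) (iB : {ghom C -> B}).
Variables (jA : {ghom A -> Gamma}) (jB : {ghom B -> Gamma}).
Hypothesis inj_iA : injective iA.
Hypothesis inj_iB : injective iB.
Hypothesis amalgam : is_amalgamated_product iA iB jA jB.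

(** The elements satisfying [P] form a subgroup that receives [A] and [B]. The induced map from
    [Gamma] to it, followed by the inclusion, is the identity by uniqueness. *)
Lemma amalgam_generated (P : Gamma -> Prop) :
  P 1 -> (forall g h, P g -> P h -> P (g * h)) -> (forall g, P g -> P g^-1) ->
  (forall a, P (jA a)) -> (forall b, P (jB b)) -> forall g, P g.
Proof.
move=> P1 PM PV PA PB.
pose Q : {pred Gamma} := fun g => `[< P g >].
have QP g : g \in Q <-> P g by split=> [/asboolP|?] //; apply/asboolP.
have clQ : group_closed Q.
  by split=> [|g h /QP Pg /QP Ph]; apply/QP => //; apply/PM/PV.
have [fA hA] : exists F : {ghom A -> subgroup_of clQ}, forall x, val (F x) = jA x.
  by apply: ghom_corestrict => a; apply/QP.
have [fB hB] : exists F : {ghom B -> subgroup_of clQ}, forall x, val (F x) = jB x.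
  by apply: ghom_corestrict => b; apply/QP.
have [c|h [h1 h2 _]] := amalgam_univ amalgam (f := fA) (g := fB).
  by apply/val_inj; rewrite hA hB (amalgam_comm amalgam).
have [v hv] := ghom_subgroup_val clQ.
have [F hF] : exists F : {ghom Gamma -> Gamma}, forall x, F x = val (h x).
  by apply: ghom_of => x y; rewrite gmulfM valM.
have [I hI] : exists F : {ghom Gamma -> Gamma}, forall x, F x = x by apply: ghom_of.
have [k [_ _ k3]] := amalgam_univ amalgam (amalgam_comm amalgam).
move=> g; apply/QP; suff <- : val (h g) = g by apply: valP.
rewrite -hF -[RHS]hI (k3 F) ?(k3 I) // => x.
- by rewrite hF h1 hA.
- by rewrite hF h2 hB.
Qed.

Definition letterA (s : A + B) : option A := if s is inl a then Some a else None.
Definition letterB (s : A + B) : option B := if s is inr b then Some b else None.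

(** Van der Waerden's argument: both factors act by bijections on the set of normal forms, and the
    universal property extends the two actions to [Gamma]. *)
Lemma amalgam_action : inhabited (alternating_action iA iB jA jB).
Proof.
have [dA [dAK dAM dA1]] := coset_decomposition inj_iA.
have [dB [dBK dBM dB1]] := coset_decomposition inj_iB.
pose ok (s : A + B) := match s with
  | inl a => a <> 1 /\ dA a = (1, a)
  | inr b => b <> 1 /\ dB b = (1, b) end.
(* Normal forms: nontrivial coset representatives, alternately from [A] and from [B]. *)
pose V := fix V (l : seq (A + B)) : Prop := if l is s :: l' then
  [/\ ok s, V l' & match s with
    | inl _ => ~~ starts letterA l' | inr _ => ~~ starts letterB l' end] else True.
pose X := {x : C * seq (A + B) | V x.2}.
have VA l : V l -> starts letterA l -> exists t l',
    [/\ l = inl t :: l', t <> 1, dA t = (1, t) & V l' /\ ~~ starts letterA l'].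
  by case: l => [|[a|b] l] //= [[a1 da] Vl sl] _; exists a, l.
have VB l : V l -> starts letterB l -> exists t l',
    [/\ l = inr t :: l', t <> 1, dB t = (1, t) & V l' /\ ~~ starts letterB l'].
  by case: l => [|[a|b] l] //= [[a1 da] Vl sl] _; exists b, l.
have VcA t l : V l -> ~~ starts letterA l -> t <> 1 -> dA t = (1, t) ->
  V (inl t :: l) by [].
have VcB t l : V l -> ~~ starts letterB l -> t <> 1 -> dB t = (1, t) ->
  V (inr t :: l) by [].
have pA : pcancel (@inl A B) letterA by [].
have pB : pcancel (@inr A B) letterB by [].
have ext (x y : X) : sval x = sval y -> x = y.
  by case: x y => x Vx [y Vy] /= e; subst y; congr exist; apply: Prop_irrelevance.
pose actA a (x : X) : X := exist (fun y => V y.2)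
  (normal_act iA dA inl letterA a (sval x)) (V_normal_act dAK dAM pA VA VcA a (svalP x)).
pose actB b (x : X) : X := exist (fun y => V y.2)
  (normal_act iB dB inr letterB b (sval x)) (V_normal_act dBK dBM pB VB VcB b (svalP x)).
have [FA hFA] : exists F : {ghom A -> bijection X}, forall a x, F a x = actA a x.
  apply: ghom_of_action => [x|g h x]; apply: ext => /=.
    by apply: (normal_act1 dAM dA1 pA VA); exact: (svalP x).
  by apply: (normal_actM dAK pA VA); exact: (svalP x).
have [FB hFB] : exists F : {ghom B -> bijection X}, forall b x, F b x = actB b x.
  apply: ghom_of_action => [x|g h x]; apply: ext => /=.
    by apply: (normal_act1 dBM dB1 pB VB); exact: (svalP x).
  by apply: (normal_actM dBK pB VB); exact: (svalP x).
have baseA c (x : X) : sval (FA (iA c) x) = (c * (sval x).1, (sval x).2).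
  rewrite hFA /=; case: x => -[c' l] Vl /=.
  exact: (normal_act_base dAM dA1 pA VA).
have baseB c (x : X) : sval (FB (iB c) x) = (c * (sval x).1, (sval x).2).
  rewrite hFB /=; case: x => -[c' l] Vl /=.
  exact: (normal_act_base dBM dB1 pB VB).
have [c|F [F1 F2 _]] := amalgam_univ amalgam (f := FA) (g := FB).
  by apply: bijection_ext => x; apply: ext; rewrite baseA baseB.
constructor.
apply: (@AlternatingAction _ _ _ _ iA iB jA jB X (fun g x => F g x)
  (exist (fun y => V y.2) (1, [::]) I) (fun x => starts letterA (sval x).2)
  (fun x => starts letterB (sval x).2)) => //.
- by move=> x; rewrite gmulf1.
- by move=> g h x; rewrite gmulfM.
- by case=> -[c [|[a|b] l]].
- move=> a [[c l] Vl] /= sl ac; rewrite F1 hFA /=.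
  exact: (normal_act_starts dAK pA).
- move=> b [[c l] Vl] /= sl bc; rewrite F2 hFB /=.
  exact: (normal_act_starts dBK pB).
- by move=> c x; rewrite F1 baseA.
by move=> c /(congr1 (fun x => (sval x).1)); rewrite F1 baseA /= mulg1.
Qed.

End Amalgam.

(** * Rewriting words of the amalgam *)

Section Syllables.
Variables (A B C Gamma : groupType).
Variables (iA : {ghom C -> A}) (iB : {ghom C -> B}).
Variables (jA : {ghom A -> Gamma}) (jB : {ghom B -> Gamma}).
Hypothesis commC : forall c, jA (iA c) = jB (iB c).
Variables (SA : seq A) (SB : seq B).

(* A syllable is a single letter of [A] or a whole word over the generators
   of [B]. *)
Notation syllable := (A + seq B)%type.

Definition amalgam_generators : seq Gamma :=
  [seq jA a | a <- SA] ++ [seq jB b | b <- SB].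
Notation S := amalgam_generators.

Lemma amalgam_generatorsA a : a \in SA -> jA a \in S.
Proof. by move=> h; rewrite mem_cat map_f. Qed.

Lemma amalgam_generatorsB b : b \in SB -> jB b \in S.
Proof. by move=> h; rewrite mem_cat map_f ?orbT. Qed.

Definition syllable_word (s : syllable) : seq Gamma :=
  match s with inl a => [:: jA a] | inr v => [seq jB b | b <- v] end.

Definition syllables_word (l : seq syllable) : seq Gamma :=
  flatten [seq syllable_word s | s <- l].

Fixpoint valid (l : seq syllable) : Prop := if l is s :: l' then
  match s with inl a => letter SA a | inr v => word SB v end /\ valid l'
  else True.

Lemma valid_cat l1 l2 : valid (l1 ++ l2) <-> valid l1 /\ valid l2.
Proof. by elim: l1 => [|s l1 IH] /=; [tauto | rewrite IH; tauto]. Qed.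

Lemma valid_inl u : valid (map inl u) <-> word SA u.
Proof. by elim: u => [|a u IH] //=; rewrite word_cons IH. Qed.

Lemma syllables_word_cat l1 l2 :
  syllables_word (l1 ++ l2) = syllables_word l1 ++ syllables_word l2.
Proof. by rewrite /syllables_word map_cat flatten_cat. Qed.

Lemma syllables_word_cons s l :
  syllables_word (s :: l) = syllable_word s ++ syllables_word l.
Proof. by []. Qed.

Lemma syllables_word_inl u : syllables_word (map inl u) = map jA u.
Proof. by elim: u => //= a u <-. Qed.

Variables (r L M : nat).

(** In [StepLeft] and [StepRight] an element of [C] is split off the end of an [A]-word next to a
    [B]-syllable and joined to it as [w]. In [StepAbsorb] the word [w] does not enter the result; as
    a short [B]-word for the same element it bounds the change of the integral. *)
Inductive step : seq syllable -> seq syllable -> Prop :=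
| StepShorten u u' : word SA u' -> size u <= r -> size u' < size u ->
    word_value u = word_value u' -> step (map inl u) (map inl u')
| StepLeft v w c u u' : word SB w -> size w <= M -> word_value w = iB c ->
    word SA u' -> size u <= r -> size u' < size u ->
    word_value u = iA c * word_value u' ->
    step (inr v :: map inl u) (inr (v ++ w) :: map inl u')
| StepRight v w c u u' : word SB w -> size w <= M -> word_value w = iB c ->
    word SA u' -> size u <= r -> size u' < size u ->
    word_value u = word_value u' * iA c ->
    step (map inl u ++ [:: inr v]) (map inl u' ++ [:: inr (w ++ v)])
| StepMerge v v' : step [:: inr v; inr v'] [:: inr (v ++ v')]
| StepAbsorb v w c u : word SB w -> size w <= M -> word_value w = iB c ->
    word_value v = iB c -> word SA u -> size u <= L -> word_value u = iA c ->
    step [:: inr v] (map inl u).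

Lemma step_valid X Y : valid X -> step X Y -> valid Y.
Proof.
move=> + XY; case: XY => [u u' wu' _ _ _ _|v w c u u' ww _ _ wu' _ _ _ [wv _]
  |v w c u u' ww _ _ wu' _ _ _|v v' /=|v w c u _ _ _ _ wu _ _ _].
- by rewrite valid_inl.
- by rewrite /= valid_inl word_cat.
- by rewrite !valid_cat !valid_inl /= word_cat; tauto.
- by rewrite word_cat; tauto.
- by rewrite valid_inl.
Qed.

Definition syllables_value (l : seq syllable) : Gamma :=
  word_value (syllables_word l).

Lemma syllables_value_cat l1 l2 :
  syllables_value (l1 ++ l2) = syllables_value l1 * syllables_value l2.
Proof. by rewrite /syllables_value syllables_word_cat value_cat. Qed.

Lemma syllables_value_inl u : syllables_value (map inl u) = jA (word_value u).
Proof. by rewrite /syllables_value syllables_word_inl gmulf_word_value. Qed.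

Lemma syllables_value_inr v l :
  syllables_value (inr v :: l) = jB (word_value v) * syllables_value l.
Proof. by rewrite /syllables_value syllables_word_cons value_cat -gmulf_word_value. Qed.

Lemma syllables_value_nil : syllables_value [::] = 1.
Proof. exact: value_nil. Qed.

Lemma step_value X Y : step X Y -> syllables_value X = syllables_value Y.
Proof.
case=> [u u' _ _ _ e|v w c u u' _ _ ew _ _ _ e|v w c u u' _ _ ew _ _ _ e|v v'
  |v w c u _ _ _ ev _ _ eu].
- by rewrite !syllables_value_inl e.
- rewrite !syllables_value_inr !syllables_value_inl e value_cat gmulfM ew gmulfM.
  by rewrite commC gmulgA.
- rewrite !syllables_value_cat !syllables_value_inl !syllables_value_inr.
  by rewrite syllables_value_nil e value_cat !gmulfM ew commC !mulg1 gmulgA.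
- rewrite !syllables_value_inr syllables_value_nil value_cat gmulfM.
  by rewrite !mulg1.
rewrite syllables_value_inl syllables_value_inr syllables_value_nil ev eu.
by rewrite commC mulg1.
Qed.

(** A potential for termination: a [B]-syllable outweighs the at most [L] letters that may replace
    it. *)
Definition weight (s : syllable) : nat := if s is inr _ then L.+1 else 1.
Definition weights (l : seq syllable) : nat := sumn (map weight l).

Lemma weights_cat l1 l2 : weights (l1 ++ l2) = weights l1 + weights l2.
Proof. by rewrite /weights map_cat sumn_cat. Qed.

Lemma weights_inl u : weights (map inl u) = size u.
Proof. by rewrite /weights; elim: u => //= a u ->. Qed.

Lemma weights_inr v l : weights (inr v :: l) = L.+1 + weights l.
Proof. by []. Qed.

Lemma step_weights X Y : step X Y -> weights Y < weights X.
Proof.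
case=> [u u' _ _ h _|v w c u u' _ _ _ _ _ h _|v w c u u' _ _ _ _ _ h _|v v'
  |v w c u _ _ _ _ _ h _].
- by rewrite !weights_inl.
- by rewrite !weights_inr !weights_inl ltn_add2l.
- by rewrite !weights_cat !weights_inl ltn_add2r.
- by rewrite !weights_inr; clear; lia.
by rewrite weights_inl weights_inr addn0 ltnS.
Qed.

(** * The cost of rewriting in the integral *)

Variables (p K : nat) (x y : Gamma -> int).
Hypothesis lx : lipschitz S p x.
Hypothesis ly : lipschitz S p y.
Hypothesis LIB : forall x y : B -> int,
  lipschitz SB p x -> lipschitz SB p y ->
  forall g w, word SB w -> word_value w = 1 ->
  (`|integral x y g w| <= (K * size w)%:Z)%R.

(* The integral over a syllable list is bounded by its total charge: [K] per
   letter of [B], and enough per letter of [A] and per [B]-syllable to pay for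
   the steps that delete them. *)
Definition chargeA : nat := K * M + 2 * (p * r) ^ 2 + (p * (M + r)) ^ 2.
Definition chargeB : nat := chargeA * L + K * M + 2 * (p * M) ^ 2 + (p * L) ^ 2.
Definition charge (s : syllable) : nat :=
  if s is inr v then chargeB + K * size v else chargeA.
Definition charges (l : seq syllable) : nat := sumn (map charge l).

Lemma charges_cat l1 l2 : charges (l1 ++ l2) = charges l1 + charges l2.
Proof. by rewrite /charges map_cat sumn_cat. Qed.

Lemma charges_inl u : charges (map inl u) = (chargeA * size u)%N.
Proof. by rewrite /charges; elim: u => [|a u /= ->]; rewrite ?muln0 ?mulnS. Qed.

Lemma charges_inr v l : charges (inr v :: l) = chargeB + K * size v + charges l.
Proof. by []. Qed.

(** The words [v] and [w] are compared inside [B], where the linear bound applies to the functions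
    pulled back along [jB]. Both [w] and [u] are short, so the other errors depend only on [M] and
    [L]. *)
Lemma integral_absorb g v w u c :
  word SB v -> word SB w -> size w <= M -> word_value w = iB c ->
  word_value v = iB c -> word SA u -> size u <= L -> word_value u = iA c ->
  (`|integral x y g (map jB v) - integral x y g (map jA u)| <=
    (K * size v + K * M + 2 * (p * M) ^ 2 + (p * L) ^ 2)%:Z)%R.
Proof.
move=> wv ww wM vw vv wu uL vu.
pose x' h := x (g * jB h); pose y' h := y (g * jB h).
have lx' : lipschitz SB p x' := lipschitz_comp g amalgam_generatorsB lx.
have ly' : lipschitz SB p y' := lipschitz_comp g amalgam_generatorsB ly.
have LIxy h t := @LIB x' y' lx' ly' h t.
have := linear_integral_defect 1 LIxy lx' ly' wv ww; rewrite vv vw => /(_ erefl).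
rewrite /x' /y' -integral_comp !gmulf1 !mulg1 !mul1g.
have := integral_defect g lx ly (word_map amalgam_generatorsA wu).
rewrite -gmulf_word_value vu commC size_map.
set I1 := integral _ _ _ _; set I2 := integral _ _ _ _; set e := (x g * _)%R.
move=> h1 h2; apply: le_trans (ler_distD e _ _) _; rewrite (distrC e).
apply: le_trans (lerD h2 h1) _; rewrite -PoszD lez_nat.
have : (p * size w) ^ 2 <= (p * M) ^ 2 by rewrite leq_exp2r // leq_mul2l wM orbT.
have : (p * size u) ^ 2 <= (p * L) ^ 2 by rewrite leq_exp2r // leq_mul2l uL orbT.
have : K * size w <= K * M by rewrite leq_mul2l wM orbT.
rewrite mulnDr; move: ((p * _) ^ 2)%N ((p * _) ^ 2)%N ((p * _) ^ 2)%N ((p * _) ^ 2)%N.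
by move: (K * _)%N (K * _)%N (K * _)%N; clear; lia.
Qed.

Lemma step_integral g X Y : valid X -> step X Y ->
  (`|integral x y g (syllables_word X) - integral x y g (syllables_word Y)| +
    (charges Y)%:Z <= (charges X)%:Z)%R.
Proof.
pose e0 := (2 * (p * r) ^ 2 + (p * (M + r)) ^ 2)%N.
have swap h u U : word SA u -> size u <= r -> word S U -> size U <= M + r ->
    word_value (map jA u) = word_value U ->
    (`|integral x y h (map jA u) - integral x y h U| <= e0%:Z)%R.
  move=> wu ur wU Ur vU; have wu' := word_map amalgam_generatorsA wu.
  apply: le_trans (integral_same_value h lx ly wu' wU vU) _; rewrite lez_nat size_map.
  rewrite /e0 leq_add ?leq_exp2r ?leq_mul2l ?Ur ?orbT //.
  rewrite mul2n -addnn (leq_trans _ (leq_addr _ _)) // leq_exp2r //.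
  by rewrite leq_mul2l ur orbT.
(* One lost letter of [A] releases [chargeA], which covers the change [e0] of the integral and [K]
   for each of the at most [M] letters added to a [B]-word. *)
have pay (u u' : seq A) (e : nat) : size u' < size u -> e <= M ->
    e0 + (K * e + chargeA * size u') <= chargeA * size u.
  move=> uu eM; apply: leq_trans (leq_mul (leqnn chargeA) uu).
  have : K * e <= K * M by rewrite leq_mul2l eM orbT.
  have : chargeA = (K * M + e0)%N by rewrite /chargeA /e0 addnA.
  rewrite mulnS; move: chargeA (K * e)%N (K * M)%N => cA a b -> ab.
  by rewrite addnA leq_add2r addnC leq_add2r.
move=> vX XY; case: XY vX => [u u' wu' ur uu e|v w c u u' ww wM ew wu' ur uu e
  |v w c u u' ww wM ew wu' ur uu e|v v'|v w c u ww wM ew ev wu uL eu].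
- rewrite valid_inl => wu; rewrite !syllables_word_inl !charges_inl.
  have := swap g u _ wu ur (word_map amalgam_generatorsA wu').
  rewrite -!gmulf_word_value e size_map => h.
  apply: le_trans (lerD (h _ erefl) (lexx _)) _; last first.
    by have := pay u u' 0 uu isT; rewrite muln0 add0n -PoszD lez_nat.
  by move: uu ur; move: (size u) (size u'); clear; lia.
- move=> /= [wv]; rewrite valid_inl => wu.
  rewrite !syllables_word_cons !syllables_word_inl /= map_cat -catA.
  rewrite !charges_inr !charges_inl size_cat.
  have eU : word_value (map jA u) = word_value (map jB w ++ map jA u').
    by rewrite value_cat -!gmulf_word_value e ew gmulfM commC.
  have wU : word S (map jB w ++ map jA u').
    rewrite word_cat; split; first exact: word_map amalgam_generatorsB ww.
    exact: word_map amalgam_generatorsA wu'.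
  have := integral_replace x y g (map jB v) [::] eU; rewrite !cats0 => ->.
  apply: le_trans (lerD (swap _ u _ wu ur wU _ eU) (lexx _)) _.
    by rewrite size_cat !size_map leq_add // ltnW // (leq_trans uu).
  have := pay u u' _ uu wM; rewrite -PoszD lez_nat mulnDr.
  by move: (K * size w)%N (K * size v)%N (chargeA * _)%N (chargeA * _)%N; clear; lia.
- rewrite valid_cat valid_inl => -[wu [wv _]].
  rewrite !syllables_word_cat !syllables_word_inl !syllables_word_cons !cats0 /= map_cat.
  rewrite !charges_cat !charges_inl !charges_inr size_cat catA.
  have eU : word_value (map jA u) = word_value (map jA u' ++ map jB w).
    by rewrite value_cat -!gmulf_word_value e ew gmulfM commC.
  have wU : word S (map jA u' ++ map jB w).
    rewrite word_cat; split; first exact: word_map amalgam_generatorsA wu'.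
    exact: word_map amalgam_generatorsB ww.
  have /= -> := integral_replace x y g [::] (map jB v) eU.
  apply: le_trans (lerD (swap _ u _ wu ur wU _ eU) (lexx _)) _.
    by rewrite size_cat !size_map addnC leq_add // ltnW // (leq_trans uu).
  have := pay u u' _ uu wM; rewrite -PoszD lez_nat mulnDr.
  by move: (K * size w)%N (K * size v)%N (chargeA * _)%N (chargeA * _)%N; clear; lia.
- move=> _; rewrite !syllables_word_cons /= map_cat !cats0 subrr normr0 add0r lez_nat.
  rewrite !charges_inr size_cat mulnDr; move: (K * _)%N (K * _)%N chargeB.
  by clear; lia.
move=> [wv _]; rewrite syllables_word_inl syllables_word_cons /= cats0.
apply: le_trans (lerD (integral_absorb g wv ww wM ew ev wu uL eu) (lexx _)) _.
rewrite charges_inl charges_inr -PoszD lez_nat /chargeB.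
have : chargeA * size u <= chargeA * L by rewrite leq_mul2l uL orbT.
move: (chargeA * _)%N (chargeA * _)%N ((p * _) ^ 2)%N ((p * _) ^ 2)%N (K * _)%N (K * _)%N.
by clear; lia.
Qed.

Definition irreducible (l : seq syllable) : Prop :=
  forall l1 X Y l2, l = l1 ++ X ++ l2 -> ~ step X Y.

(** Induction on the weight: a nonempty list of trivial value can be rewritten, and a step changes
    the integral by no more than it lowers the charge. *)
Lemma integral_syllables g l :
  (forall l, valid l -> irreducible l -> syllables_value l = 1 -> l = [::]) ->
  valid l -> syllables_value l = 1 ->
  (`|integral x y g (syllables_word l)| <= (charges l)%:Z)%R.
Proof.
move=> irr; have [n] := ubnP (weights l); elim: n l => // n IH l ln vl l1.
have [ir|] := pselect (irreducible l); first by rewrite (irr l).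
move=> /existsNP[k1] /existsNP[X] /existsNP[Y] /existsNP[k2].
move=> /not_implyP[lE] /contrapT st; move: ln vl l1; rewrite lE.
rewrite !valid_cat !syllables_value_cat !weights_cat (step_value st).
move=> ln [v1 [vX v2]] l1; have vY := step_valid vX st.
have := IH (k1 ++ Y ++ k2); rewrite !valid_cat !syllables_value_cat !weights_cat.
have lt_n : weights k1 + (weights Y + weights k2) < n.
  move: (step_weights st) ln; move: (weights k1) (weights k2) (weights X) (weights Y).
  by clear; lia.
have vk : valid k1 /\ valid Y /\ valid k2 by [].
move=> /(_ lt_n vk l1); rewrite !syllables_word_cat !charges_cat => ih.
have := step_integral (g * word_value (syllables_word k1)) vX st.
rewrite -(integral_replace _ _ _ _ (syllables_word k2) (step_value st)).
move: ih; move: (integral _ _ _ _) (integral _ _ _ _).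
move: (charges k1) (charges k2) (charges X) (charges Y).
by clear; lia.
Qed.

End Syllables.

(** * Irreducible syllable lists *)

Section Irreducible.
Variables (A B C : groupType) (iA : {ghom C -> A}) (iB : {ghom C -> B}).
Variables (SA : seq A) (SB : seq B).
Hypothesis genA : generates SA.
(** Twice the Gromov products at corners are bounded by [a] through quasi-convexity and by [b]
    through malnormality; [m] separates short from long [A]-segments, and [c0] is the bound carried
    along a list. In irreducible lists, [B]-syllables lying in [C] have [A]-length above [L]. *)
Variables (D a b m c0 L M : nat).
Hypothesis hyp : four_point SA D.
Notation len := (word_length SA).
Notation syllable := (A + seq B)%type.
Definition in_base (G : groupType) (i : {ghom C -> G}) (g : G) : Prop :=
  exists c, g = i c.
Notation H := (in_base iA).

Hypothesis prefix_product : forall p c, word SA p -> size p = len (word_value p) ->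
  (forall n h, n <= size p -> H h -> n <= len (h * word_value (take n p))) ->
  H c -> len c + len (word_value p) <= len (c * word_value p) + a.
Hypothesis malnormal_product : forall u c c', ~ H u -> len u <= m -> H c -> H c' ->
  len c + len (u * c') <= len (c * (u * c')) + b.
Hypothesis am : 2 * (a + D) < m.
Hypothesis abm : a + b + D + 2 * m <= c0.
Hypothesis large : 2 * c0 + b + 4 * m + 2 * D < L.
Hypothesis short_base : forall c, len (iA c) <= maxn L (6 * m) ->
  exists w, [/\ word SB w, word_value w = iB c & size w <= M].

Notation step := (step iA iB SA SB (3 * m) L M).
Notation irreducible := (irreducible iA iB SA SB (3 * m) L M).
Notation valid := (valid SA SB).

Lemma base1 : H 1.
Proof. by exists 1; rewrite gmulf1. Qed.

Lemma baseM g h : H g -> H h -> H (g * h).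
Proof. by move=> [c ->] [c' ->]; exists (c * c'); rewrite gmulfM. Qed.

Lemma baseV g : H g -> H g^-1.
Proof. by move=> [c ->]; exists c^-1; rewrite gmulfV. Qed.

Lemma irreducible_infix l1 l l2 : irreducible (l1 ++ l ++ l2) -> irreducible l.
Proof.
move=> irr k1 X Y k2 lE; apply: (irr (l1 ++ k1) X Y (k2 ++ l2)).
by rewrite lE -!catA.
Qed.

Lemma irreducible_catl l1 l2 : irreducible (l1 ++ l2) -> irreducible l1.
Proof. by move=> irr; apply: (@irreducible_infix [::] l1 l2). Qed.

Lemma irreducible_catr l1 l2 : irreducible (l1 ++ l2) -> irreducible l2.
Proof. by move=> irr; apply: (@irreducible_infix l1 l2 [::]); rewrite cats0. Qed.

Lemma irreducible_local_geodesic u l : word SA u ->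
  irreducible (map inl u ++ l) -> local_geodesic SA (3 * m) u.
Proof.
move=> wu irr; apply: contrapT => /(not_local_geodesic genA wu).
move=> [u1 [u2 [u3 [v [uE ur wv [vv sv]]]]]].
apply: (irr (map inl u1) (map inl u2) (map inl v) (map inl u3 ++ l)).
  by rewrite uE !map_cat -!catA.
by apply: StepShorten; rewrite // vv.
Qed.

(** Otherwise [StepLeft] moves [h^-1] into [v]: its length in [A] is below [6 * m], so it has a
    short word in [B]. *)
Lemma irreducible_prefix v u l n h : word SA u ->
  irreducible (inr v :: map inl u ++ l) -> n <= size u -> n <= 3 * m -> H h ->
  n <= len (h * word_value (take n u)).
Proof.
move=> wu irr nu nr [c ->]; rewrite leqNgt; apply/negP => short.
set p := take n u in short; have sp : size p = n by rewrite size_takel.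
have wp : word SA p by apply: word_take.
have [p' [wp' vp' sp']] := geodesic_word genA (iA c * word_value p).
have [|w [ww vw wM]] := short_base (c := c^-1).
  rewrite leq_max; apply/orP; right; rewrite gmulfV lenV //.
  have := lenM genA (iA c * word_value p) (word_value p)^-1; rewrite mulgK lenV //.
  have := len_le wp; rewrite sp; move: short nr.
  by move: (len _) (len _) (len _); clear; lia.
apply: (irr [::] (inr v :: map inl p) (inr (v ++ w) :: map inl p')
  (map inl (drop n u) ++ l)).
  by rewrite /= catA -map_cat cat_take_drop.
apply: (@StepLeft _ _ _ iA iB SA SB _ _ _ v w _ p p' ww wM vw wp').
- by rewrite sp.
- by rewrite sp' sp.
by rewrite vp' gmulfV mulKg.
Qed.

Lemma irreducible_suffix v u l n h : word SA u ->
  irreducible (map inl u ++ inr v :: l) -> n <= size u -> n <= 3 * m -> H h ->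
  n <= len (word_value (drop (size u - n) u) * h).
Proof.
move=> wu irr nu nr [c ->]; rewrite leqNgt; apply/negP => short.
set p := drop _ u in short; have sp : size p = n by rewrite size_drop subKn.
have wp : word SA p by apply: word_drop.
have [p' [wp' vp' sp']] := geodesic_word genA (word_value p * iA c).
have [|w [ww vw wM]] := short_base (c := c^-1).
  rewrite leq_max; apply/orP; right; rewrite gmulfV lenV //.
  have := lenM genA (word_value p)^-1 (word_value p * iA c); rewrite mulKg lenV //.
  have := len_le wp; rewrite sp; move: short nr.
  by move: (len _) (len _) (len _); clear; lia.
apply: (irr (map inl (take (size u - n) u)) (map inl p ++ [:: inr v])
  (map inl p' ++ [:: inr (w ++ v)]) l).
  by rewrite -!catA catA -map_cat cat_take_drop.
apply: (@StepRight _ _ _ iA iB SA SB _ _ _ v w _ p p' ww wM vw wp').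
- by rewrite sp.
- by rewrite sp' sp.
by rewrite vp' gmulfV mulgK.
Qed.

Lemma irreducible_merge l1 v v' l2 :
  ~ irreducible (l1 ++ inr v :: inr v' :: l2).
Proof.
by move=> irr; apply: (irr l1 [:: inr v; inr v'] [:: inr (v ++ v')] l2) => //;
  apply: StepMerge.
Qed.

Lemma irreducible_long l1 v l2 c : word_value v = iB c ->
  irreducible (l1 ++ inr v :: l2) -> L < len (iA c).
Proof.
move=> vc irr; rewrite ltnNge; apply/negP => short.
have [|w [ww vw wM]] := short_base (c := c); first by rewrite leq_max short.
have [u [wu vu su]] := geodesic_word genA (iA c).
apply: (irr l1 [:: inr v] (map inl u) l2) => //.
by apply: (@StepAbsorb _ _ _ iA iB SA SB _ _ _ v w c u ww wM vw vc wu); rewrite ?su.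
Qed.

Lemma irreducible_prefix_product v u l u1 u2 h : word SA u ->
  irreducible (inr v :: map inl u ++ l) -> u = u1 ++ u2 -> size u1 <= 3 * m ->
  H h -> len h + len (word_value u1) <= len (h * word_value u1) + a.
Proof.
move=> wu irr uE u1m; have lu : local_geodesic SA (3 * m) u.
  by apply: (irreducible_local_geodesic wu (l := l)); apply: (@irreducible_catr [:: inr v]).
move: wu lu; rewrite uE word_cat => -[wu1 wu2] /local_geodesic_cat[lu1 _].
apply: prefix_product => //; first by rewrite (local_geodesic_len wu1 lu1).
move=> n h' nu1 Hh'; have -> : take n u1 = take n u by rewrite uE takel_cat.
apply: irreducible_prefix irr _ _ Hh'; rewrite ?uE ?word_cat ?size_cat //.
  by rewrite (leq_trans nu1) // leq_addr.
exact: leq_trans u1m.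
Qed.

(** The prefix estimate, applied to the inverse word. *)
Lemma irreducible_suffix_product v u l u1 u2 h : word SA u ->
  irreducible (map inl u ++ inr v :: l) -> u = u1 ++ u2 -> size u2 <= 3 * m ->
  H h -> len (word_value u2) + len h <= len (word_value u2 * h) + a.
Proof.
move=> wu irr uE u2m Hh; have lu := irreducible_local_geodesic wu irr.
move: (wu) lu; rewrite {1 2}uE word_cat => -[wu1 wu2] /local_geodesic_cat[_ lu2].
have gu2 := local_geodesic_len wu2 lu2 u2m.
have := @prefix_product (word_inv u2) h^-1 (word_word_inv wu2).
rewrite value_word_inv -ginvgM !lenV // size_word_inv gu2 addnC.
apply=> //; last exact: baseV.
move=> n h' nu2 Hh'; rewrite value_take_word_inv.
have -> : (word_value u2)^-1 * word_value (take (size u2 - n) u2) =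
    (word_value (drop (size u2 - n) u2))^-1.
  by rewrite -{1}(cat_take_drop (size u2 - n) u2) value_cat ginvgM mulgVK.
have nu : n <= size u by rewrite uE size_cat (leq_trans nu2) // leq_addl.
have := irreducible_suffix wu irr nu (leq_trans nu2 u2m) (baseV Hh').
rewrite -(lenV genA (h' * _)) ginvgM invgK uE size_cat drop_cat.
by rewrite -addnBA // ltnNge leq_addr /= addKn.
Qed.

(* Meaningful only when the value of [v] lies in the image of [C]. *)
Definition base_value (v : seq B) : A :=
  iA (xget 1 (fun c => word_value v = iB c)).

Lemma base_valueP v : in_base iB (word_value v) ->
  exists c, word_value v = iB c /\ base_value v = iA c.
Proof.
move=> ex; have := xgetPex 1 ex; rewrite /base_value.
by set c := xget _ _ => vc; exists c.
Qed.

(** For lists whose [B]-syllables all lie in [C], this is the value, computed in [A]. *)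
Definition a_value (l : seq syllable) : A := \prod_(s <- l)
  (match s with inl x => x | inr v => base_value v end).

Definition all_base (l : seq syllable) : Prop :=
  forall v, inr v \in l -> in_base iB (word_value v).

Lemma a_value_inl u l : a_value (map inl u ++ l) = word_value u * a_value l.
Proof. by rewrite /a_value big_cat big_map. Qed.

Lemma a_value_inr v l : a_value (inr v :: l) = base_value v * a_value l.
Proof. by rewrite /a_value big_cons. Qed.

Lemma a_value_nil : a_value [::] = 1.
Proof. by rewrite /a_value big_nil. Qed.

Lemma all_base_cat l1 l2 : all_base (l1 ++ l2) -> all_base l1 /\ all_base l2.
Proof. by move=> h; split=> v vl; apply: h; rewrite mem_cat vl ?orbT. Qed.

Lemma syllables_parse (l : seq syllable) : exists u l',
  l = map inl u ++ l' /\ (l' = [::] \/ exists v l'', l' = inr v :: l'').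
Proof.
elim: l => [|[x|v] l [u [l' [-> h]]]]; first by exists [::], [::]; split; [|left].
  by exists (x :: u), l'.
exists [::], (inr v :: map inl u ++ l'); split=> //; right.
by exists v, (map inl u ++ l').
Qed.

Definition open_left (l : seq syllable) : Prop :=
  forall h, H h -> len h + len (a_value l) <= len (h * a_value l) + c0.

Definition tail_open (l : seq syllable) : Prop :=
  l = [::] \/ exists v l', [/\ l = inr v :: l', in_base iB (word_value v) &
    open_left l'].

Lemma irreducible_base v l1 l2 : irreducible (l1 ++ inr v :: l2) ->
  in_base iB (word_value v) -> H (base_value v) /\ L < len (base_value v).
Proof.
move=> irr /base_valueP[c [vc ->]]; split; first by exists c.
exact: irreducible_long vc irr.
Qed.

(** At the end of [u], a suffix loses at most [a] against the next [B]-syllable, seen in [A]. That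
    element is longer than [L], so whatever follows it adds only [D] to the loss. *)
Lemma long_segment u l : word SA u -> irreducible (map inl u ++ l) ->
  tail_open l -> m <= size u ->
  m <= len (word_value u * a_value l) + a + D /\
  forall h, (forall u1 u2, u = u1 ++ u2 -> m <= size u1 < 2 * m ->
     len h + len (word_value u1) <= len (h * word_value u1) + a) ->
  len h + len (word_value u * a_value l) <=
    len (h * (word_value u * a_value l)) + a + D.
Proof.
move=> wu irr tl mu; apply: (local_geodesic_extend genA hyp wu) => //.
- exact: irreducible_local_geodesic irr.
- by move: am; clear; lia.
move=> u1 u2 uE /andP[mu2 u2m].
case: tl irr => [->|[v [l' [-> vC ol']]]] irr.
  by rewrite a_value_nil len1 mulg1; clear; lia.
have [Hv Lv] := irreducible_base irr vC.
rewrite a_value_inr; apply: (broken_geodesic genA hyp (b := c0)).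
- apply: irreducible_suffix_product irr uE _ Hv => //.
  by move: u2m; clear; lia.
- by have := ol' _ Hv; clear; lia.
by move: large abm Lv; clear; lia.
Qed.

Lemma prefix_base_trivial v u l : word SA u -> irreducible (inr v :: map inl u ++ l) ->
  size u <= m -> H (word_value u) -> u = [::].
Proof.
move=> wu irr um Hu; apply: size0nil; apply/eqP; rewrite -leqn0.
have := irreducible_prefix wu irr (leqnn _) _ (baseV Hu).
by rewrite take_size mulVg len1; apply; move: um; clear; lia.
Qed.

(** Induction along the list. A long first segment is covered by [long_segment]. A short one before
    a [B]-syllable lies outside [C], since otherwise it is empty and two [B]-syllables merge;
    malnormality then bounds the corner by [b]. The next element of [C] is so long that the
    resulting bound is [b + D], at most [c0], and the constant does not grow. *)
Lemma irreducible_open_left v0 l : valid l -> all_base l ->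
  irreducible (inr v0 :: l) -> open_left l.
Proof.
have [n] := ubnP (size l); elim: n v0 l => // n IH v0 l ln vl bl irr h Hh.
have [u [l' [lE l'E]]] := syllables_parse l; move: vl bl irr ln.
rewrite lE a_value_inl valid_cat valid_inl => -[wu vl'] /all_base_cat[_ bl'] irr ln.
have irr' : irreducible (map inl u ++ l') := @irreducible_catr [:: inr v0] _ irr.
have tl : tail_open l'.
  case: l'E vl' bl' irr' ln => [->|[v [l'' ->]]]; first by left.
  move=> vl' bl' irr' ln; right; exists v, l''; split=> //.
    by apply: bl'; rewrite mem_head.
  apply: (IH v) => //; first by rewrite size_cat /= in ln; move: ln; clear; lia.
  - by case: vl'.
  - by move=> w wl; apply: bl'; rewrite inE wl orbT.
  exact: irreducible_catr irr'.
have [um|mu] := ltnP (size u) m; last first.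
  have [_ /(_ h)] := long_segment wu irr' tl mu.
  have pre : forall u1 u2, u = u1 ++ u2 -> m <= size u1 < 2 * m ->
      len h + len (word_value u1) <= len (h * word_value u1) + a.
    move=> u1 u2 uE /andP[_ u1m]; apply: irreducible_prefix_product irr uE _ Hh => //.
    by move: u1m; clear; lia.
  by move=> /(_ pre); move: abm; clear; lia.
have lu : len (word_value u) < m by apply: leq_ltn_trans um; apply: len_le.
case: tl irr irr' => [->|[v [l'' [-> vC ol]]]] irr irr'.
  rewrite a_value_nil mulg1.
  have := lenM genA (h * word_value u) (word_value u)^-1; rewrite mulgK lenV //.
  by move: lu abm; move: (len _) (len _) (len _); clear; lia.
have [Hv Lv] := irreducible_base irr' vC.
rewrite a_value_inr; set c := base_value v in Hv Lv *; set t := a_value l''.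
have nHu : ~ H (word_value u).
  move=> Hu; have u0 := prefix_base_trivial wu irr (ltnW um) Hu.
  by move: irr; rewrite u0; apply: (@irreducible_merge [::]).
have h1 := malnormal_product nHu (ltnW lu) Hh Hv.
have h2 : len (word_value u * c) + len t <=
    len (word_value u * c * t) + (c0 + 2 * m) + D.
  have := ol _ Hv; have := lenM genA (word_value u) c.
  have := lenM genA (word_value u)^-1 (word_value u * c * t).
  rewrite -!gmulgA mulKg lenV //; move: lu.
  by move: (len _) (len _) (len _) (len _) (len _) (len _); clear; lia.
have h3 : len c <= len (word_value u * c) + m.
  have := lenM genA (word_value u)^-1 (word_value u * c); rewrite mulKg lenV //.
  by move: lu; move: (len _) (len _) (len _); clear; lia.
have := broken_geodesic genA hyp h1 h2; rewrite -!gmulgA => bg.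
apply: leq_trans (bg _) _; last by move: abm; clear; lia.
by move: large abm h3 Lv; clear; lia.
Qed.

Lemma irreducible_tail_open u l : valid l -> all_base l ->
  irreducible (map inl u ++ l) ->
  (l = [::] \/ exists v l', l = inr v :: l') -> tail_open l.
Proof.
move=> vl bl irr lE; case: lE vl bl irr => [->|[v [l' ->]]]; first by left.
move=> /= [_ vl'] bl' irr; right; exists v, l'; split=> //.
  by apply: bl'; rewrite mem_head.
apply: (irreducible_open_left (v0 := v)) => //; last exact: irreducible_catr irr.
by move=> w wl; apply: bl'; rewrite inE wl orbT.
Qed.

Lemma short_segment_len u v l : word SA u -> size u < m ->
  H (base_value v) -> L < len (base_value v) -> open_left l ->
  L < len (word_value u * a_value (inr v :: l)) + c0 + m.
Proof.
move=> wu um Hv Lv ol; rewrite a_value_inr; have := ol _ Hv.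
set c := base_value v in Lv *; set t := a_value l.
have := lenM genA (word_value u)^-1 (word_value u * (c * t)); rewrite mulKg lenV //.
have := len_le wu; move: um Lv.
by move: (len _) (len _) (len _) (len _) (len _); clear; lia.
Qed.

(** Were the value in [C], its inverse could be taken as [h] in the cancellation estimates, which
    would make the value short; a long segment or a [B]-syllable in [C] makes it long. In the
    remaining case the list is empty, and [v0] and [v1] merge. *)
Lemma irreducible_not_base v0 l v1 : valid l -> all_base l ->
  irreducible (inr v0 :: l ++ [:: inr v1]) -> ~ H (a_value l).
Proof.
move=> vl bl irr; have irr0 : irreducible (inr v0 :: l).
  exact: (@irreducible_infix [::] (inr v0 :: l) [:: inr v1]).
have [u [l' [lE l'E]]] := syllables_parse l; move: vl bl irr irr0; rewrite lE.
move=> vl bl irr irr0 HT; have ol := irreducible_open_left vl bl irr0.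
move: (ol _ (baseV HT)); rewrite mulVg len1 lenV //.
move: vl bl HT; rewrite a_value_inl valid_cat valid_inl.
move=> [wu vl'] /all_base_cat[_ bl'].
have irr' : irreducible (map inl u ++ l') := @irreducible_catr [:: inr v0] _ irr0.
have tl := irreducible_tail_open vl' bl' irr' l'E.
have [um|mu] := ltnP (size u) m; last first.
  move=> HT _; have [h1 /(_ _^-1)] := long_segment wu irr' tl mu.
  set T := word_value u * a_value l' in h1 HT * => h2.
  have := h2 T; rewrite mulVg len1 lenV // => h3.
  suff : len T + len T <= 0 + a + D by move: h1 am; clear; lia.
  apply: h3 => u1 u2 uE /andP[_ u1m]; rewrite -(lenV genA T).
  apply: irreducible_prefix_product irr0 uE _ (baseV HT) => //.
  by move: u1m; clear; lia.
case: tl irr irr0 irr' => [->|[v [l'' [-> vC ol']]]] irr irr0 irr'.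
  rewrite a_value_nil mulg1 => Hu _.
  have u0 := prefix_base_trivial wu irr0 (ltnW um) Hu.
  by move: irr; rewrite u0; apply: (@irreducible_merge [::]).
have [Hv Lv] := irreducible_base irr' vC.
move=> _; have := short_segment_len wu um Hv Lv ol'.
by move: large abm; move: (len _); clear; lia.
Qed.

Lemma irreducible_a_value1 l : valid l -> all_base l -> irreducible l ->
  a_value l = 1 -> l = [::].
Proof.
have [u [l' [-> l'E]]] := syllables_parse l.
rewrite a_value_inl valid_cat valid_inl => -[wu vl'] /all_base_cat[_ bl'] irr T1.
have tl := irreducible_tail_open vl' bl' irr l'E.
have [um|mu] := ltnP (size u) m; last first.
  by have [] := long_segment wu irr tl mu; rewrite T1 len1; move: am; clear; lia.
case: tl irr T1 => [->|[v [l'' [-> vC ol']]]] irr T1.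
  move: T1; rewrite a_value_nil mulg1 => u1.
  have lu := irreducible_local_geodesic wu irr.
  have := local_geodesic_len wu lu; rewrite u1 len1 => u0.
  by have /esym/size0nil -> : 0 = size u by apply: u0; move: um; clear; lia.
have [Hv Lv] := irreducible_base irr vC.
have := short_segment_len wu um Hv Lv ol'; rewrite T1 len1.
by move: large abm; clear; lia.
Qed.

(** * Ping-pong on normal forms *)

Variables (Gamma : groupType) (jA : {ghom A -> Gamma}) (jB : {ghom B -> Gamma}).
Hypothesis commC : forall c, jA (iA c) = jB (iB c).
Variable act : alternating_action iA iB jA jB.
Notation value := (syllables_value jA jB).
Notation inA := (@aa_inA _ _ _ _ _ _ _ _ act).
Notation inB := (@aa_inB _ _ _ _ _ _ _ _ act).
Notation base := (aa_base act).

Lemma value_all_base l : all_base l -> value l = jA (a_value l).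
Proof.
elim: l => [|[x|v] l IH] bl; first by rewrite syllables_value_nil a_value_nil gmulf1.
  rewrite -cat1s syllables_value_cat -[[:: inl x]]/(map inl [:: x]) a_value_inl.
  rewrite syllables_value_inl gmulfM IH // => v vl; exact: bl.
have [c [vc bc]] := base_valueP (bl v (mem_head _ _)).
rewrite syllables_value_inr a_value_inr vc bc -commC gmulfM IH // => w wl.
by apply: bl; rewrite inE wl orbT.
Qed.

Lemma all_base_split l : all_base l \/ exists l1 v l2,
  [/\ l = l1 ++ inr v :: l2, all_base l1 & ~ in_base iB (word_value v)].
Proof.
elim: l => [|s l IH]; first by left.
have [[x sE]|[v sE]] : (exists x, s = inl x) \/ (exists v, s = inr v).
- by case: s => [x|v]; [left; exists x | right; exists v].
- case: IH => [bl|[l1 [v [l2 [-> bl1 nv]]]]].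
    by left=> v; rewrite inE sE => /orP[//|]; apply: bl.
  right; exists (s :: l1), v, l2; split=> // w; rewrite inE sE => /orP[//|].
  exact: bl1.
have [vC|nv] := pselect (in_base iB (word_value v)); last first.
  by right; exists [::], v, l; rewrite sE.
case: IH => [bl|[l1 [w [l2 [-> bl1 nw]]]]].
  by left=> w; rewrite inE sE => /orP[/eqP[->]//|]; apply: bl.
right; exists (s :: l1), w, l2; split=> // z; rewrite inE sE => /orP[/eqP[->]//|].
exact: bl1.
Qed.

Lemma act_a_value l (x : aa_space act) :
  all_base l -> aa_act (value l) x = aa_act (jA (a_value l)) x.
Proof. by move/value_all_base ->. Qed.

(** By induction, the first [B]-syllable outside [C] carries what follows to a form starting in [B].
    The part before it has its value in [A] outside [C], by [irreducible_not_base], and makes the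
    form start in [A]. *)
Lemma irreducible_not_inB v0 l : valid l -> irreducible (inr v0 :: l) ->
  ~~ inB (aa_act (value l) base).
Proof.
have [n] := ubnP (size l); elim: n v0 l => // n IH v0 l ln vl irr.
have [bA bB] := aa_baseN act.
case: (all_base_split l) => [bl|[l1 [v [l2 [lE bl1 nv]]]]].
  rewrite act_a_value //; have [[c ->]|nH] := pselect (H (a_value l)).
    by have [_ ->] := aa_actC c base.
  exact/aa_disj/aa_actA.
move: ln vl irr; rewrite lE valid_cat size_cat /= => ln [vl1 [_ vl2]] irr.
have irr2 : irreducible (inr v :: l2).
  by apply: irreducible_catr; apply: (@irreducible_catr [:: inr v0]) irr.
rewrite syllables_value_cat syllables_value_inr aa_actM act_a_value // aa_actM.
have n2 : ~~ inB (aa_act (value l2) base).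
  by apply: (IH v) => //; move: ln; clear; lia.
apply/aa_disj/aa_actA.
  by apply: contraL (aa_actB n2 nv); apply: aa_disj.
apply: (irreducible_not_base (v0 := v0) (v1 := v)) => //.
by apply: (@irreducible_catl _ l2); rewrite /= -catA.
Qed.

(** A [B]-syllable outside [C] would move the base to a form starting in [A] or in [B]. Without one
    the value comes from [A], and fixing the base makes it trivial there. *)
Lemma irreducible_value1 l : valid l -> irreducible l -> value l = 1 -> l = [::].
Proof.
move=> vl irr l1; have [bA bB] := aa_baseN act.
have fix_base : aa_act (value l) base = base by rewrite l1 aa_act1.
case: (all_base_split l) => [bl|[k1 [v [k2 [lE bk nv]]]]].
  apply: irreducible_a_value1 => //; move: fix_base; rewrite act_a_value //.
  have [[c ->]|nH] := pselect (H (a_value l)).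
    by move/aa_freeC => ->; rewrite gmulf1.
  by move=> e; have := aa_actA bA nH; rewrite e (negPf bA).
move: fix_base vl irr; rewrite lE valid_cat => + [_ [_ vk2]] irr.
rewrite syllables_value_cat syllables_value_inr aa_actM act_a_value // aa_actM.
have irr2 : irreducible (inr v :: k2) by apply: irreducible_catr irr.
have hB := aa_actB (irreducible_not_inB vk2 irr2) nv.
have nA : ~~ inA (aa_act (jB (word_value v)) (aa_act (value k2) base)).
  by apply: contraL hB; apply: aa_disj.
have [[c ->]|nH] := pselect (H (a_value k1)) => e.
  have [_] := aa_actC c (aa_act (jB (word_value v)) (aa_act (value k2) base)).
  by rewrite e hB (negPf bB).
by have := aa_actA nA nH; rewrite e (negPf bA).
Qed.

End Irreducible.

(** * The combination theorem *)

(** Balls in [A] are finite; by injectivity of [iA], [xget] recovers an element of [C] from its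
    image. *)
Lemma short_base_words (A B C : groupType) (iA : {ghom C -> A}) (iB : {ghom C -> B})
    (SA : seq A) (SB : seq B) (n : nat) :
  generates SA -> generates SB -> injective iA ->
  exists M : nat, forall c, word_length SA (iA c) <= n ->
  exists w, [/\ word SB w, word_value w = iB c & size w <= M].
Proof.
move=> genA genB inj_iA; pose f a := word_length SB (iB (xget 1 (fun c => iA c = a))).
exists (\max_(a <- ball SA n) f a) => c cn.
have [w [ww vw sw]] := geodesic_word genB (iB c); exists w; split=> //.
have -> : size w = f (iA c).
  have := @xgetI _ 1 (fun c' => iA c' = iA c) c erefl.
  by rewrite sw /f => /inj_iA ->.
apply: (leq_bigmax_seq (F := f)) => //; exact: mem_ball.
Qed.

(** The change of generators is made for contour integrals, where it is a substitution of words. *)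
Lemma four_point_generators (G : groupType) (S S' : seq G) D :
  generates S -> generates S' -> four_point S D -> exists D', four_point S' D'.
Proof.
move=> gS gS' hyp; apply: linear_integrals_four_point => //.
exact: linear_integrals_generators gS gS' (four_point_linear_integrals gS hyp).
Qed.

Section Combination.
Variables (A B C Gamma : groupType).
Variables (iA : {ghom C -> A}) (iB : {ghom C -> B}).
Variables (jA : {ghom A -> Gamma}) (jB : {ghom B -> Gamma}).
Hypothesis inj_iA : injective iA.
Hypothesis inj_iB : injective iB.
Hypothesis amalgam : is_amalgamated_product iA iB jA jB.
Variables (SA : seq A) (SB : seq B).
Hypothesis genA : generates SA.
Hypothesis genB : generates SB.
Notation S := (amalgam_generators jA jB SA SB).

Lemma generates_amalgam : generates S.
Proof.
apply: (amalgam_generated amalgam).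
- by exists [::]; rewrite ?value_nil.
- by move=> g h [w ww <-] [w' ww' <-]; exists (w ++ w'); rewrite ?word_cat ?value_cat.
- move=> g [w ww <-]; exists (word_inv w); last exact: value_word_inv.
  exact: word_word_inv.
- move=> a; have [w ww <-] := genA a; exists (map jA w); last by rewrite gmulf_word_value.
  exact: (word_map (@amalgam_generatorsA _ _ _ jA jB SA SB)) ww.
move=> b; have [w ww <-] := genB b; exists (map jB w); last by rewrite gmulf_word_value.
exact: (word_map (@amalgam_generatorsB _ _ _ jA jB SA SB)) ww.
Qed.

(** Every letter becomes a syllable of its own, so the initial charge is linear in the length. *)
Lemma word_to_syllables r L M p K w : word S w -> exists l,
  [/\ valid SA SB l, syllables_word jA jB l = w &
    charges r L M p K l <= (chargeA r M p K + chargeB r L M p K + K) * size w].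
Proof.
elim: w => [|x w IH]; first by exists [::].
move=> /word_cons[lx /IH [l [vl <- cl]]].
have [s [vs xs cs]] : exists s : A + seq B, [/\ valid SA SB [:: s],
    syllable_word jA jB s = [:: x] &
    charge r L M p K s <= chargeA r M p K + chargeB r L M p K + K].
  have sub y : y \in S -> (exists2 a, a \in SA & y = jA a) \/
      (exists2 b, b \in SB & y = jB b).
    by rewrite mem_cat => /orP[] /mapP[z zS ->]; [left | right]; exists z.
  have [[a la ->]|[b lb ->]] : (exists2 a, letter SA a & x = jA a) \/
      (exists2 b, letter SB b & x = jB b).
    case: lx => /sub[[z zS e]|[z zS e]].
    - by left; exists z => //; left.
    - by right; exists z => //; left.
    - by left; exists z^-1; rewrite ?gmulfV -?e ?invgK //; right; rewrite invgK.
    - by right; exists z^-1; rewrite ?gmulfV -?e ?invgK //; right; rewrite invgK.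
    exists (inl a); split=> //=; rewrite -addnA leq_addr //.
  exists (inr [:: b]); split=> //=.
    by split=> //; rewrite word_cons.
  by rewrite muln1 leq_add2r leq_addl.
exists (s :: l); split.
- by split=> //; case: vs.
- by rewrite syllables_word_cons xs.
by rewrite [size _]/= mulnS leq_add.
Qed.

Variable D : nat.
Hypothesis hypA : four_point SA D.
Hypothesis quasi : quasi_convex_wrt SA (range iA).
Hypothesis mal : malnormal (range iA).
Hypothesis LIB : linear_integrals SB.

Lemma amalgam_linear_integrals : linear_integrals S.
Proof.
have rangeE : range iA = in_base iA.
  by apply/seteqP; split=> [a [c _ <-]|a [c ->]]; [exists c | exists c].
have [k' qk] := quasi; rewrite rangeE in qk; have := mal; rewrite rangeE => mal'.
have b1 := base1 iA; have bM := @baseM _ _ iA; have bV := @baseV _ _ iA.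
(* The order avoids circularity: [a] comes from quasi-convexity, [m] from [a], [b] from malnormality
   for elements of length up to [m], then [c0] and [L], and last [M], for all elements of [C] that
   the steps may have to move. *)
pose a := (4 * D + 2 * k' + 3)%N; pose m := (2 * (a + D)).+1.
have [b hb] := gromov_product_malnormal genA hypA b1 bM bV qk mal' m.
pose c0 := (a + b + D + 2 * m)%N; pose L := (2 * c0 + b + 4 * m + 2 * D).+1.
have [M hM] := short_base_words iB (maxn L (6 * m)) genA genB inj_iA.
have [act] := amalgam_action inj_iA inj_iB amalgam.
move=> p; have [K hK] := LIB p.
exists (chargeA (3 * m) M p K + chargeB (3 * m) L M p K + K)%N.
move=> x y lx ly g w /(word_to_syllables (3 * m) L M p K)[l [vl <- cl]] l1.
apply: le_trans (_ : _ <= (charges (3 * m) L M p K l)%:Z)%R _; last by rewrite lez_nat.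
apply: (integral_syllables (amalgam_comm amalgam) lx ly hK) => // l' vl' irr' l1'.
apply: (irreducible_value1 genA hypA (a := a) (b := b) (m := m) (c0 := c0) _ _ _ _ _
  hM (amalgam_comm amalgam) act vl' irr' l1') => //.
by move=> q c wq gq near Hc; apply: (gromov_product_prefix genA hypA b1 bV qk).
Qed.

End Combination.

Theorem theorem6p4 (A B C Gamma : groupType)
    (iA : {ghom C -> A}) (iB : {ghom C -> B})
    (jA : {ghom A -> Gamma}) (jB : {ghom B -> Gamma}) :
  hyperbolic A -> hyperbolic B -> finitely_generated C ->
  injective iA -> injective iB ->
  quasi_convex (range iA) -> malnormal (range iA) ->
  is_amalgamated_product iA iB jA jB ->
  hyperbolic Gamma.
Proof.
move=> [S0 gen0 /(hyperbolic_four_point gen0)[D0 hyp0]].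
move=> [SB genB /(hyperbolic_four_point genB)[DB hypB]] _ inj_iA inj_iB.
move=> [SA genA quasi] mal amalgam.
(* Quasi-convexity comes with its own generating set, to which the four-point condition is carried
   over. *)
have [D hypA] := four_point_generators gen0 genA hyp0.
have genG := generates_amalgam amalgam genA genB.
exists (amalgam_generators jA jB SA SB) => //; apply/hyperbolic_four_point => //.
apply: linear_integrals_four_point => //.
apply: (amalgam_linear_integrals inj_iA inj_iB amalgam genA genB hypA quasi mal).
exact: four_point_linear_integrals genB hypB.
Qed.
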